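(* Let $m\in\mathbb{N}$ and let $f(z)=\sum_{n=m}^\infty a_nz^n$ and $g(z)=\sum_{n=m}^\infty b_nz^n$ be analytic in $\mathbb{D}$ with $g\prec f$ and $a_n\neq 0$ for all $n\geq m$. Then $\mathcal{M}_g(r)\leq \mathcal{M}_f(r)$ for all $r=|z|\leq \inf_{n\geq m}|a_{n+1}/a_n|$, $z\in\mathbb{D}$. If instead $m=0$ (the other hypotheses being the same), then $\mathcal{M}_g(r)\leq\mathcal{M}_f(r)$ for all $r=|z|\leq \inf_{n\geq 1}|a_{n+1}/a_n|$, $z\in\mathbb{D}$.
   Context: $\mathbb{D}$ denotes the open unit disk in $\mathbb{C}$ and $\mathbb{N}$ the set of positive integers. For a complex valued analytic function $F(z)=\sum_{n=0}^\infty A_nz^n$ in $\mathbb{D}$, its majorant series is $\mathcal{M}_F(r):=\sum_{n=0}^\infty |A_n|r^n$ for $0\le r<1$. For analytic functions $f,g$ in $\mathbb{D}$, $g\prec f$ ($g$ is subordinate to $f$) means that there is a function $\phi$ analytic in $\mathbb{D}$ with $\phi(0)=0$ and $|\phi(z)|<1$ for $z\in\mathbb{D}$ such that $g=f\circ\phi$. *)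

(* Defs.v *)
From Stdlib Require Import Reals.
From Coquelicot Require Import Coquelicot.

Open Scope R_scope.

Definition in_disk (z : C) : Prop := Cmod z < 1.

(* Only the values of [F] on the disk matter: the radius [rho] may be shrunk
   so that the disk of center [z0] lies inside the unit disk. *)
Definition analytic_in_disk (F : C -> C) : Prop :=
  forall z0 : C, in_disk z0 ->
    exists (c : nat -> C) (rho : R), 0 < rho /\
      forall z : C, Cmod (z - z0)%C < rho ->
        @is_pseries C_AbsRing C_NormedModule c (z - z0)%C (F z).

(* F(z) = sum_{n >= m} A_n z^n on the disk. The coefficient sequence is indexed
   from 0 and vanishes below [m]. *)
Definition expansion_from (m : nat) (A : nat -> C) (F : C -> C) : Prop :=
  (forall n : nat, (n < m)%nat -> A n = RtoC 0) /\
  (forall z : C, in_disk z ->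
     @is_pseries C_AbsRing C_NormedModule A z (F z)).

(* Majorant series of the analytic function with Taylor coefficients [A].
   [Series] is total, but for 0 <= r < 1 the series converges as soon as
   sum A_n z^n converges for every z in the disk. *)
Definition majorant_series (A : nat -> C) (r : R) : R :=
  Series (fun n : nat => Cmod (A n) * r ^ n).

Definition subordinate (g f : C -> C) : Prop :=
  exists phi : C -> C,
    analytic_in_disk phi /\
    phi (RtoC 0) = RtoC 0 /\
    (forall z : C, in_disk z -> Cmod (phi z) < 1) /\
    (forall z : C, in_disk z -> g z = f (phi z)).

(* inf_{n >= k} |A_{n+1} / A_n| *)
Definition inf_ratio (A : nat -> C) (k : nat) : Rbar :=
  Inf_seq (fun j : nat => Finite (Cmod (A (S (k + j)) / A (k + j)%nat)%C)).

(* Main.v *)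
Require Import Defs.
From Stdlib Require Import Arith Reals Lra Lia ClassicalEpsilon.
From Coquelicot Require Import Coquelicot.

(** The proof rests on Rogosinski's inequality: if [g = f o phi] with
    [phi 0 = 0] and [|phi| < 1], then
    [sum_(k <= n) |b_k|^2 <= sum_(k <= n) |a_k|^2] for every [n] ([rogosinski]).
    By summation by parts the same holds with nonincreasing nonnegative weights,
    and [r <= inf |a_(k+1) / a_k|] says precisely that [r^k / |a_k|] is such a
    weight. Hence [sum |b_k|^2 r^k / |a_k| <= sum |a_k| r^k], and the inequality
    [2 |b_k| r^k <= |b_k|^2 r^k / |a_k| + |a_k| r^k] concludes
    ([majorant_partial_sums]). When [m = 0] the constant terms are equal, so that
    they need no weight and the ratio condition starts at 1.

    Rogosinski's inequality follows from the fact that multiplication by [phi] does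
    not increase [sum_(k <= n) |h_k|^2] ([conv_contraction]), by applying Horner's
    scheme to a partial sum of [f] evaluated at [phi] ([compose_energy]).

    The contraction property is usually read off from integrals over circles, but
    [phi] is given by local power series only, and comparing its coefficients at 0
    with its values on large circles calls for some form of Cauchy's theorem. Here
    the maximum principle plays this role: it is applied to averages over roots of
    unity, which are finite sums and isolate the coefficients at 0
    ([coefficient_bound]). The maximum principle in turn is proved for functions
    that merely have a Taylor expansion of order 2 at each point
    ([maximum_principle]); this class is visibly closed under the operations needed,
    so that infinite series are never multiplied, inverted or re-expanded. *)

(** * Moduli and finite sums *)

Lemma Cmod_triangle_sub (x y : C) : Cmod x - Cmod y <= Cmod (x + y).
Proof.
  pose proof (Cmod_triangle (x + y) (- y)) as H.
  replace (x + y + - y)%C with x in H by ring. rewrite Cmod_opp in H. lra.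
Qed.

(** Replaces passing to the limit [s -> 0] in an inequality. *)
Lemma nonpos_of_small_multiples c K d :
  0 < d -> (forall s, 0 < s < d -> c <= K * s) -> c <= 0.
Proof.
  intros Hd H. apply Rnot_lt_le. intros Hc.
  assert (0 < K). { pose proof (H (d / 2) ltac:(lra)). nra. }
  set (s := Rmin (d / 2) (c / (2 * K))).
  assert (Hs : 0 < c / (2 * K)) by (apply Rdiv_lt_0_compat; lra).
  assert (Hs' : 0 < s) by (apply Rmin_glb_lt; lra).
  pose proof (Rmin_l (d / 2) (c / (2 * K))).
  pose proof (Rmin_r (d / 2) (c / (2 * K))).
  specialize (H s ltac:(unfold s in *; lra)).
  assert (K * s <= K * (c / (2 * K))) by (apply Rmult_le_compat_l; unfold s; lra).
  replace (K * (c / (2 * K))) with (c / 2) in * by (field; lra). lra.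
Qed.

Lemma Cmod2_plus_ge (x y : C) :
  Cmod x ^ 2 - 2 * Cmod x * Cmod y <= Cmod (x + y) ^ 2.
Proof.
  pose proof (Cmod_triangle_sub x y). pose proof (Cmod_ge_0 x).
  pose proof (Cmod_ge_0 y). pose proof (Cmod_ge_0 (x + y)).
  destruct (Rle_dec (Cmod x) (Cmod y)); nra.
Qed.

Lemma sum_n_C_S (f : nat -> C) n : @eq C (sum_n f (S n)) (sum_n f n + f (S n))%C.
Proof. exact (sum_Sn f n). Qed.

Lemma sum_n_R_S (f : nat -> R) n : @eq R (sum_n f (S n)) (sum_n f n + f (S n)).
Proof. exact (sum_Sn f n). Qed.

Lemma sum_n_C_scal c (f : nat -> C) n :
  @eq C (sum_n (fun k => (c * f k)%C) n) (c * sum_n f n)%C.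
Proof. exact (@sum_n_mult_l C_Ring c f n). Qed.

Lemma sum_n_C_plus (f g : nat -> C) n :
  @eq C (sum_n (fun k => (f k + g k)%C) n) (sum_n f n + sum_n g n)%C.
Proof. exact (@sum_n_plus C_AbelianMonoid f g n). Qed.

Lemma sum_n_R_scal c (f : nat -> R) n :
  @eq R (sum_n (fun k => c * f k) n) (c * sum_n f n).
Proof. exact (@sum_n_mult_l R_Ring c f n). Qed.

Lemma sum_n_R_plus (f g : nat -> R) n :
  @eq R (sum_n (fun k => f k + g k) n) (sum_n f n + sum_n g n).
Proof. exact (@sum_n_plus R_AbelianMonoid f g n). Qed.

Lemma sum_n_R_le (f g : nat -> R) n :
  (forall k, (k <= n)%nat -> f k <= g k) -> sum_n f n <= sum_n g n.
Proof.
  induction n as [|n IH]; intros H.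
  - rewrite !sum_O. auto.
  - rewrite !sum_n_R_S. apply Rplus_le_compat; auto.
Qed.

Lemma sum_n_R_first (f : nat -> R) n :
  @eq R (sum_n f (S n)) (f 0%nat + sum_n (fun k => f (S k)) n).
Proof.
  induction n as [|n IH].
  - rewrite sum_n_R_S, !sum_O. reflexivity.
  - rewrite sum_n_R_S, IH, (sum_n_R_S _ n). ring.
Qed.

Lemma sum_n_RtoC (f : nat -> R) n :
  @eq C (sum_n (fun k => RtoC (f k)) n) (RtoC (sum_n f n)).
Proof.
  induction n as [|n IH].
  - now rewrite !sum_O.
  - now rewrite sum_n_C_S, sum_n_R_S, IH, RtoC_plus.
Qed.

Lemma Cmod_sum_n (f : nat -> C) n :
  Cmod (sum_n f n) <= sum_n (fun k => Cmod (f k)) n.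
Proof.
  induction n as [|n IH].
  - rewrite !sum_O. lra.
  - rewrite sum_n_C_S, sum_n_R_S. eapply Rle_trans; [apply Cmod_triangle|]. lra.
Qed.

(** * Partial sums of power series *)

Definition cpoly (A : nat -> C) (n : nat) (z : C) : C :=
  sum_n (fun k => (A k * z ^ k)%C) n.

Lemma cpoly_0 A z : cpoly A 0 z = A 0%nat.
Proof. unfold cpoly. rewrite sum_O. simpl. ring. Qed.

Lemma cpoly_last A n z :
  cpoly A (S n) z = (cpoly A n z + A (S n) * z ^ S n)%C.
Proof. unfold cpoly. now rewrite sum_Sn. Qed.

(** The Horner step, along which products, inverses and composites are treated
    by induction. *)
Lemma cpoly_first A n z :
  cpoly A (S n) z = (A 0%nat + z * cpoly (fun k => A (S k)) n z)%C.
Proof.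
  induction n as [|n IH].
  - rewrite cpoly_last, !cpoly_0. simpl. ring.
  - rewrite cpoly_last, IH, (cpoly_last _ n). simpl. ring.
Qed.

Lemma cpoly_ext A B n z :
  (forall k, (k <= n)%nat -> A k = B k) -> cpoly A n z = cpoly B n z.
Proof.
  intros H. apply sum_n_ext_loc. intros k Hk. now rewrite H.
Qed.

Lemma cpoly_conj A n z :
  Cconj (cpoly A n z) = cpoly (fun k => Cconj (A k)) n (Cconj z).
Proof.
  induction n as [|n IH].
  - now rewrite !cpoly_0.
  - rewrite !cpoly_last, Cplus_conj, IH, Cmult_conj, Cpow_conj. reflexivity.
Qed.

Lemma cpoly_scale_arg A n c z :
  cpoly A n (c * z) = cpoly (fun k => (A k * c ^ k)%C) n z.
Proof.
  induction n as [|n IH].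
  - rewrite !cpoly_0. simpl. ring.
  - rewrite !cpoly_last, IH, Cpow_mult_l. ring.
Qed.

Lemma cpoly_plus A B n z :
  cpoly (fun k => (A k + B k)%C) n z = (cpoly A n z + cpoly B n z)%C.
Proof.
  induction n as [|n IH].
  - now rewrite !cpoly_0.
  - rewrite !cpoly_last, IH. ring.
Qed.

(** * Taylor expansions of finite order *)

(** The bound [d <= 1] makes powers of [Cmod w] decrease with the exponent, so
    that a higher order implies a lower one. The point [w = 0] is included:
    for [n > 0] the function has to vanish there. *)
Definition bigO (n : nat) (E : C -> C) : Prop :=
  exists K d : R, 0 <= K /\ 0 < d <= 1 /\
    forall w, Cmod w < d -> Cmod (E w) <= K * Cmod w ^ n.

Lemma bigO_ext n E F :
  (exists d, 0 < d /\ forall w, Cmod w < d -> E w = F w) -> bigO n E -> bigO n F.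
Proof.
  intros (d & Hd & He) (K & e & HK & Hd' & H).
  exists K, (Rmin d e). split; [easy|]. split.
  - unfold Rmin; destruct (Rle_dec d e); lra.
  - intros w Hw. pose proof (Rmin_l d e). pose proof (Rmin_r d e).
    rewrite <- He by lra. apply H. lra.
Qed.

Lemma bigO_eq n E F : (forall w, E w = F w) -> bigO n E -> bigO n F.
Proof. intros H. apply bigO_ext. exists 1. split; [lra|auto]. Qed.

Lemma bigO_plus n E F : bigO n E -> bigO n F -> bigO n (fun w => (E w + F w)%C).
Proof.
  intros (K & d & HK & Hd & H) (K' & d' & HK' & Hd' & H').
  exists (K + K'), (Rmin d d'). split; [lra|]. split.
  - unfold Rmin; destruct (Rle_dec d d'); lra.
  - intros w Hw. pose proof (Rmin_l d d'). pose proof (Rmin_r d d').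
    eapply Rle_trans; [apply Cmod_triangle|].
    specialize (H w ltac:(lra)). specialize (H' w ltac:(lra)). lra.
Qed.

Lemma bigO_mult n m E F :
  bigO n E -> bigO m F -> bigO (n + m) (fun w => (E w * F w)%C).
Proof.
  intros (K & d & HK & Hd & H) (K' & d' & HK' & Hd' & H').
  exists (K * K'), (Rmin d d'). split; [nra|]. split.
  - unfold Rmin; destruct (Rle_dec d d'); lra.
  - intros w Hw. pose proof (Rmin_l d d'). pose proof (Rmin_r d d').
    rewrite Cmod_mult, pow_add.
    specialize (H w ltac:(lra)). specialize (H' w ltac:(lra)).
    replace (K * K' * (Cmod w ^ n * Cmod w ^ m))
      with ((K * Cmod w ^ n) * (K' * Cmod w ^ m)) by ring.
    apply Rmult_le_compat; auto using Cmod_ge_0.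
Qed.

Lemma bigO_le n m E : (n <= m)%nat -> bigO m E -> bigO n E.
Proof.
  intros Hnm (K & d & HK & Hd & H). exists K, d. split; [easy|]. split; [easy|].
  intros w Hw. eapply Rle_trans; [now apply H|].
  apply Rmult_le_compat_l; [easy|].
  replace m with (n + (m - n))%nat by lia. rewrite pow_add.
  pose proof (pow_le (Cmod w) n (Cmod_ge_0 w)).
  assert (Cmod w ^ (m - n) <= 1).
  { rewrite <- (pow1 (m - n)). apply pow_incr. split; [apply Cmod_ge_0|lra]. }
  nra.
Qed.

Lemma bigO_const c : bigO 0 (fun _ => c).
Proof.
  exists (Cmod c), 1. split; [apply Cmod_ge_0|]. split; [lra|].
  intros w _. simpl. lra.
Qed.

Lemma bigO_id : bigO 1 (fun w => w).
Proof.
  exists 1, 1. split; [lra|]. split; [lra|]. intros w _. simpl. lra.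
Qed.

Lemma bigO_zero n : bigO n (fun _ => RtoC 0).
Proof.
  exists 0, 1. split; [lra|]. split; [lra|]. intros w _.
  rewrite Cmod_0. lra.
Qed.

Lemma bigO_scal n c E : bigO n E -> bigO n (fun w => (c * E w)%C).
Proof. intros H. exact (bigO_mult 0 n _ _ (bigO_const c) H). Qed.

Lemma bigO_pow n : bigO n (fun w => (w ^ n)%C).
Proof.
  exists 1, 1. split; [lra|]. split; [lra|]. intros w _. rewrite Cmod_pow. lra.
Qed.

Lemma bigO_cpoly A n : bigO 0 (cpoly A n).
Proof.
  induction n as [|n IH].
  - apply (bigO_eq _ (fun _ => A 0%nat)); [|apply bigO_const].
    intros w. now rewrite cpoly_0.
  - apply (bigO_eq _ (fun w => (cpoly A n w + A (S n) * w ^ S n)%C)).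
    + intros w. now rewrite cpoly_last.
    + apply bigO_plus; [easy|]. apply bigO_scal.
      apply (bigO_le 0 (S n)); [lia|apply bigO_pow].
Qed.

Lemma bigO_comp n E h : bigO n E -> bigO 1 h -> bigO n (fun w => E (h w)).
Proof.
  intros (K & d & HK & Hd & H) (K' & d' & HK' & Hd' & H').
  assert (Hq : 0 < d / (K' + 1)) by (apply Rdiv_lt_0_compat; lra).
  exists (K * K' ^ n), (Rmin d' (d / (K' + 1))). split.
  - apply Rmult_le_pos; [easy|]. now apply pow_le.
  - split; [unfold Rmin; destruct Rle_dec; lra|].
    intros w Hw. pose proof (Rmin_l d' (d / (K' + 1))).
    pose proof (Rmin_r d' (d / (K' + 1))).
    specialize (H' w ltac:(lra)). rewrite pow_1 in H'.
    assert (Cmod w * (K' + 1) < d).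
    { apply (Rmult_lt_reg_r (/ (K' + 1))); [apply Rinv_0_lt_compat; lra|].
      rewrite Rmult_assoc, Rinv_r by lra. unfold Rdiv in *. lra. }
    pose proof (Cmod_ge_0 w).
    eapply Rle_trans; [apply H; nra|].
    rewrite Rmult_assoc, <- Rpow_mult_distr.
    apply Rmult_le_compat_l; [easy|]. apply pow_incr.
    split; [apply Cmod_ge_0|easy].
Qed.

(** A Taylor expansion at a single point, with no demand on nearby points.
    This is much weaker than analyticity, but stable under sums, products and
    inverses, and order 2 is all that the maximum principle below asks for. *)
Definition expands (n : nat) (F : C -> C) (z0 : C) (A : nat -> C) : Prop :=
  bigO (S n) (fun w => (F (z0 + w) - cpoly A n w)%C).

Definition expandable (n : nat) (F : C -> C) (z0 : C) : Prop :=
  exists A, expands n F z0 A.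

Lemma expands_local n F G z0 A :
  (exists d, 0 < d /\ forall w, Cmod w < d -> F (z0 + w)%C = G (z0 + w)%C) ->
  expands n F z0 A -> expands n G z0 A.
Proof.
  intros (d & Hd & H). apply bigO_ext. exists d. split; [easy|].
  intros w Hw. now rewrite H.
Qed.

Lemma expands_bounded n F z0 A :
  expands n F z0 A -> bigO 0 (fun w => F (z0 + w)%C).
Proof.
  intros H.
  apply (bigO_eq _ (fun w => ((F (z0 + w) - cpoly A n w) + cpoly A n w)%C)).
  - intros w. ring.
  - apply bigO_plus; [|apply bigO_cpoly]. now apply (bigO_le 0 (S n)); [lia|].
Qed.

Lemma expands_plus n F G z0 A B :
  expands n F z0 A -> expands n G z0 B ->
  expands n (fun z => (F z + G z)%C) z0 (fun k => (A k + B k)%C).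
Proof.
  intros HF HG. eapply bigO_eq; [|exact (bigO_plus _ _ _ HF HG)].
  intros w. simpl. rewrite cpoly_plus. ring.
Qed.

Lemma expands_const n c z0 :
  expands n (fun _ => c) z0 (fun k => match k with 0%nat => c | _ => RtoC 0 end).
Proof.
  apply (bigO_eq _ (fun _ => RtoC 0)); [|apply bigO_zero].
  intros w. symmetry.
  replace (cpoly _ n w) with c; [ring|].
  induction n as [|n IH].
  - now rewrite cpoly_0.
  - rewrite cpoly_last, <- IH. ring.
Qed.

Lemma expandable_id n z0 : expandable n (fun z => z) z0.
Proof.
  exists (fun k => match k with 0%nat => z0 | 1%nat => RtoC 1 | _ => RtoC 0 end).
  destruct n as [|n].
  - eapply bigO_eq; [|apply bigO_id]. intros w. simpl. rewrite cpoly_0. ring.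
  - apply (bigO_eq _ (fun _ => RtoC 0)); [|apply bigO_zero].
    intros w. symmetry. replace (cpoly _ (S n) w) with (z0 + w)%C; [ring|].
    induction n as [|n IH].
    + rewrite cpoly_last, cpoly_0. simpl. ring.
    + rewrite cpoly_last, <- IH. ring.
Qed.

(** The coefficients of a product, by recursion on the first factor so as to
    follow [cpoly_first]. *)
Fixpoint conv (A B : nat -> C) (k : nat) : C :=
  match k with
  | 0%nat => (A 0%nat * B 0%nat)%C
  | S k' => (A 0%nat * B k + conv (fun i => A (S i)) B k')%C
  end.

Lemma conv_ext_r A B B' k :
  (forall i, (i <= k)%nat -> B i = B' i) -> conv A B k = conv A B' k.
Proof.
  revert A. induction k as [|k IH]; intros A H; simpl.
  - now rewrite H.
  - rewrite H by lia. rewrite (IH _ (fun i Hi => H i ltac:(lia))). reflexivity.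
Qed.

Lemma cpoly_conv_first A B n w :
  cpoly (conv A B) (S n) w
  = (A 0%nat * cpoly B (S n) w + w * cpoly (conv (fun i => A (S i)) B) n w)%C.
Proof.
  induction n as [|n IH].
  - rewrite !cpoly_last, !cpoly_0. simpl. ring.
  - rewrite cpoly_last, IH, (cpoly_last B (S n)),
      (cpoly_last (conv (fun i => A (S i)) B) n). simpl. ring.
Qed.

(** Only monomials of degree above [n] are lost when a product of two partial
    sums is replaced by the partial sum of the Cauchy product. *)
Lemma bigO_cpoly_conv A B n :
  bigO (S n) (fun w => (cpoly A n w * cpoly B n w - cpoly (conv A B) n w)%C).
Proof.
  revert A. induction n as [|n IH]; intros A.
  - apply (bigO_eq _ (fun _ => RtoC 0)); [|apply bigO_zero].
    intros w. rewrite !cpoly_0. simpl. ring.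
  - pose proof (bigO_mult 1 (S n) _ _ bigO_id (IH (fun i => A (S i)))) as H1.
    pose proof (bigO_mult 0 _ _ _ (bigO_cpoly (fun i => A (S i)) n)
      (bigO_scal _ (B (S n)) _ (bigO_pow (S (S n))))) as H2.
    eapply bigO_eq; [|exact (bigO_plus _ _ _ H1 H2)].
    intros w. simpl.
    rewrite cpoly_conv_first, (cpoly_first A), (cpoly_last B). simpl. ring.
Qed.

(** [F G - P Q = (F - P) G + P (G - Q)] for the partial sums [P] and [Q]. *)
Lemma expands_mult n F G z0 A B :
  expands n F z0 A -> expands n G z0 B ->
  expands n (fun z => (F z * G z)%C) z0 (conv A B).
Proof.
  intros HF HG.
  assert (H1 := bigO_mult _ 0 _ _ HF (expands_bounded _ _ _ _ HG)).
  assert (H2 := bigO_mult 0 _ _ _ (bigO_cpoly A n) HG).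
  rewrite Nat.add_0_r in H1. simpl in H2.
  eapply bigO_eq;
    [|exact (bigO_plus _ _ _ (bigO_plus _ _ _ H1 H2) (bigO_cpoly_conv A B n))].
  intros w. simpl. ring.
Qed.

Lemma expandable_const n c z0 : expandable n (fun _ => c) z0.
Proof. eexists. apply expands_const. Qed.

Lemma expandable_plus n F G z0 :
  expandable n F z0 -> expandable n G z0 ->
  expandable n (fun z => (F z + G z)%C) z0.
Proof. intros (A & HA) (B & HB). eexists. now apply expands_plus; eauto. Qed.

Lemma expandable_mult n F G z0 :
  expandable n F z0 -> expandable n G z0 ->
  expandable n (fun z => (F z * G z)%C) z0.
Proof. intros (A & HA) (B & HB). eexists. now apply expands_mult; eauto. Qed.

Lemma expandable_local n F G z0 :
  (exists d, 0 < d /\ forall w, Cmod w < d -> F (z0 + w)%C = G (z0 + w)%C) ->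
  expandable n F z0 -> expandable n G z0.
Proof. intros H (A & HA). exists A. eapply expands_local; eauto. Qed.

Lemma expandable_eq n F G z0 :
  (forall z, F z = G z) -> expandable n F z0 -> expandable n G z0.
Proof. intros H. apply expandable_local. exists 1. split; [lra|auto]. Qed.

Lemma expandable_cpoly n A m Q z0 :
  expandable n Q z0 -> expandable n (fun z => cpoly A m (Q z)) z0.
Proof.
  intros HQ. revert A. induction m as [|m IH]; intros A.
  - apply (expandable_eq _ (fun _ => A 0%nat)); [|apply expandable_const].
    intros z. now rewrite cpoly_0.
  - eapply expandable_eq; [intros z; symmetry; apply cpoly_first|].
    apply expandable_plus; [apply expandable_const|].
    now apply expandable_mult.
Qed.

Lemma expandable_sum n (F : nat -> C -> C) m z0 :
  (forall j, (j <= m)%nat -> expandable n (F j) z0) ->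
  expandable n (fun z => sum_n (fun j => F j z) m) z0.
Proof.
  induction m as [|m IH]; intros H.
  - apply (expandable_eq _ (F 0%nat)); [|auto].
    intros z. now rewrite sum_O.
  - apply (expandable_eq _ (fun z => (sum_n (fun j => F j z) m + F (S m) z)%C)).
    + intros z. now rewrite sum_Sn.
    + apply expandable_plus; auto.
Qed.

Lemma expandable_rotate n F c z0 :
  expandable n F (c * z0)%C -> expandable n (fun z => F (c * z)%C) z0.
Proof.
  intros (A & HA). exists (fun k => (A k * c ^ k)%C).
  eapply bigO_eq; [|exact (bigO_comp _ _ (fun w => (c * w)%C) HA
                             (bigO_scal _ c _ bigO_id))].
  intros w. simpl. now rewrite cpoly_scale_arg, Cmult_plus_distr_l.
Qed.

(** Geometric series: [1 / (z0 + w) = 1 / z0 - (w / z0) (1 / (z0 + w))], so each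
    step of the induction multiplies the remainder by [- w / z0]. *)
Lemma expandable_inv n z0 : z0 <> RtoC 0 -> expandable n Cinv z0.
Proof.
  intros Hz. pose proof (proj1 (Cmod_gt_0 z0) Hz) as Hp.
  assert (Hd : exists d, 0 < d <= 1 /\ d <= Cmod z0 / 2).
  { exists (Rmin 1 (Cmod z0 / 2)). pose proof (Rmin_l 1 (Cmod z0 / 2)).
    pose proof (Rmin_r 1 (Cmod z0 / 2)).
    repeat split; try lra. apply Rmin_glb_lt; lra. }
  destruct Hd as (d & Hd & Hd2).
  assert (Hnear : forall w, Cmod w < d -> Cmod z0 / 2 <= Cmod (z0 + w)).
  { intros w Hw. pose proof (Cmod_triangle_sub z0 w). lra. }
  assert (Hnz : forall w, Cmod w < d -> (z0 + w)%C <> RtoC 0).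
  { intros w Hw. apply Cmod_gt_0. specialize (Hnear w Hw). lra. }
  assert (HO : bigO 0 (fun w => (/ (z0 + w))%C)).
  { exists (/ (Cmod z0 / 2)), d. split.
    - left. apply Rinv_0_lt_compat. lra.
    - split; [easy|]. intros w Hw. rewrite Cmod_inv by auto.
      simpl. rewrite Rmult_1_r. apply Rinv_le_contravar; [lra|auto]. }
  exists (fun k => (/ z0 * (- / z0) ^ k)%C).
  induction n as [|n IH].
  - eapply bigO_ext.
    2: exact (bigO_scal _ (- / z0)%C _ (bigO_mult 1 0 _ _ bigO_id HO)).
    exists d. split; [lra|]. intros w Hw. simpl. rewrite cpoly_0.
    specialize (Hnz w Hw). simpl. now field.
  - eapply bigO_ext.
    2: exact (bigO_scal _ (- / z0)%C _ (bigO_mult 1 _ _ _ bigO_id IH)).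
    exists d. split; [lra|]. intros w Hw. simpl. rewrite cpoly_first.
    replace (cpoly (fun k => (/ z0 * (- / z0) ^ S k)%C) n w)
      with (- / z0 * cpoly (fun k => (/ z0 * (- / z0) ^ k)%C) n w)%C.
    + specialize (Hnz w Hw). simpl. now field.
    + clear. induction n as [|n IH].
      * rewrite !cpoly_0. simpl. ring.
      * rewrite !cpoly_last, <- IH. simpl. ring.
Qed.

(** Divide by the variable and recurse. The division loses the point [w = 0],
    hence the weaker hypothesis [H'] on punctured disks used for the
    induction. *)
Lemma cpoly_bigO_zero A n :
  bigO (S n) (cpoly A n) -> forall k, (k <= n)%nat -> A k = RtoC 0.
Proof.
  intros (K & d & HK & Hd & H).
  assert (H' : forall w, 0 < Cmod w < d -> Cmod (cpoly A n w) <= K * Cmod w ^ S n)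
    by (intros w Hw; apply H; lra).
  clear H. revert A H'. induction n as [|n IH]; intros A H.
  - intros k Hk. replace k with 0%nat by lia. apply Cmod_eq_0.
    apply Rle_antisym; [|apply Cmod_ge_0].
    apply (nonpos_of_small_multiples _ K d); [easy|]. intros s Hs.
    specialize (H (RtoC s)). rewrite Cmod_R, Rabs_pos_eq, cpoly_0 in H by lra.
    specialize (H Hs). lra.
  - assert (H0 : A 0%nat = RtoC 0).
    { destruct (bigO_cpoly (fun k => A (S k)) n) as (K' & d' & HK' & Hd' & HP).
      apply Cmod_eq_0. apply Rle_antisym; [|apply Cmod_ge_0].
      apply (nonpos_of_small_multiples _ (K + K') (Rmin d d')); [apply Rmin_glb_lt; lra|].
      intros s Hs. pose proof (Rmin_l d d'). pose proof (Rmin_r d d').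
      specialize (H (RtoC s)). specialize (HP (RtoC s)).
      rewrite Cmod_R, Rabs_pos_eq in H, HP by lra. rewrite cpoly_first in H.
      specialize (H ltac:(lra)). specialize (HP ltac:(lra)).
      pose proof (Cmod_triangle_sub (A 0%nat)
        (RtoC s * cpoly (fun k => A (S k)) n (RtoC s))) as Ht.
      rewrite Cmod_mult, Cmod_R, Rabs_pos_eq in Ht by lra.
      simpl in H, HP.
      assert (s ^ n <= 1) by (rewrite <- (pow1 n); apply pow_incr; lra).
      assert (0 <= s ^ n) by (apply pow_le; lra).
      assert (s * s^n <= 1) by nra. assert (0 <= s * s^n) by nra.
      assert (K * (s * (s * s ^ n)) <= K * s).
      { apply Rmult_le_compat_l; [easy|]. nra. }
      nra. }
    assert (HS : forall k, (k <= n)%nat -> A (S k) = RtoC 0).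
    { apply (IH (fun k => A (S k))). intros w Hw.
      specialize (H w Hw). rewrite cpoly_first, H0, Cplus_0_l, Cmod_mult in H.
      simpl in H |- *.
      apply (Rmult_le_reg_l (Cmod w)); [easy|].
      eapply Rle_trans; [exact H|]. right. ring. }
    intros [|k] Hk; [easy|apply HS; lia].
Qed.

Lemma expands_unique n F z0 A B :
  expands n F z0 A -> expands n F z0 B ->
  forall k, (k <= n)%nat -> A k = B k.
Proof.
  intros HA HB k Hk.
  assert (H : bigO (S n) (cpoly (fun k => (A k - B k)%C) n)).
  { eapply bigO_eq;
      [|exact (bigO_plus _ _ _ HB (bigO_scal _ (-(1))%C _ HA))].
    intros w. simpl.
    replace (cpoly (fun k => (A k - B k)%C) n w) with (cpoly A n w - cpoly B n w)%C.
    - ring.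
    - clear. induction n as [|n IH].
      + now rewrite !cpoly_0.
      + rewrite !cpoly_last, <- IH. ring. }
  pose proof (cpoly_bigO_zero _ _ H k Hk) as E. simpl in E.
  replace (A k) with (A k - B k + B k)%C by ring. rewrite E. ring.
Qed.

Lemma expands_value n F z0 A : expands n F z0 A -> F z0 = A 0%nat.
Proof.
  intros (K & d & HK & Hd & H). specialize (H (RtoC 0)).
  rewrite Cmod_0, Cplus_0_r, (pow_ne_zero (S n)), Rmult_0_r in H by lia.
  assert (E0 : cpoly A n 0 = A 0%nat).
  { destruct n as [|n]; [apply cpoly_0|]. rewrite cpoly_first. ring. }
  rewrite E0 in H.
  assert (E : (F z0 - A 0%nat)%C = RtoC 0).
  { apply Cmod_eq_0, Rle_antisym; [apply H; lra|apply Cmod_ge_0]. }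
  replace (F z0) with (F z0 - A 0%nat + A 0%nat)%C by ring. rewrite E. ring.
Qed.

(** * Expansions of analytic functions *)

Lemma cpoly_pseries (c : nat -> C) (w : C) n :
  @eq C (@sum_n C_NormedModule
    (fun k => @scal C_AbsRing C_NormedModule (@pow_n C_AbsRing w k) (c k)) n)
    (cpoly c n w).
Proof.
  unfold cpoly. apply (@sum_n_ext C_AbelianMonoid). intros i.
  assert (E : @pow_n C_AbsRing w i = (w ^ i)%C).
  { induction i as [|i IH]; [reflexivity|]. simpl. rewrite IH. reflexivity. }
  rewrite E. apply Cmult_comm.
Qed.

Lemma pseries_partial_sums (c : nat -> C) (w l : C) :
  @is_pseries C_AbsRing C_NormedModule c w l ->
  forall eps, 0 < eps -> exists N : nat, forall k, (N <= k)%nat ->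
    Cmod (cpoly c k w - l) < eps.
Proof.
  intros H eps He. unfold is_pseries, is_series in H.
  destruct (proj1 (filterlim_locally_ball_norm _ _) H (mkposreal eps He))
    as (N & HN).
  exists N. intros k Hk. specialize (HN k Hk). unfold ball_norm in HN.
  rewrite <- cpoly_pseries. exact HN.
Qed.

Lemma pseries_terms_bounded (c : nat -> C) (w l : C) :
  @is_pseries C_AbsRing C_NormedModule c w l ->
  exists B, 0 <= B /\ forall k, Cmod (c k) * Cmod w ^ k <= B.
Proof.
  intros H.
  destruct (filterlim_bounded _ (ex_intro _ l H)) as (M & HM).
  assert (HM' : forall k, Cmod (cpoly c k w) <= M).
  { intros k. rewrite <- cpoly_pseries. exact (HM k). }
  pose proof (Rle_trans _ _ _ (Cmod_ge_0 _) (HM' 0%nat)) as H0.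
  exists (2 * M). split; [lra|]. intros k. rewrite <- Cmod_pow, <- Cmod_mult.
  destruct k as [|k].
  - specialize (HM' 0%nat). rewrite cpoly_0 in HM'. simpl. rewrite Cmult_1_r. lra.
  - pose proof (HM' (S k)) as H1. rewrite cpoly_last in H1.
    pose proof (Cmod_triangle_sub (c (S k) * w ^ S k) (cpoly c k w)) as H2.
    rewrite Cplus_comm in H2. specialize (HM' k). lra.
Qed.

(** The terms beyond [n] are dominated by a geometric series of ratio
    [Cmod w / r <= 1 / 2]; the factor [1 - (1 / 2) ^ p] is its partial sum. *)
Lemma cpoly_tail_bound c B r w n p :
  0 < r -> (forall k, Cmod (c k) * r ^ k <= B) -> Cmod w <= r / 2 ->
  Cmod (cpoly c (n + p) w - cpoly c n w)
  <= 2 * B * (Cmod w / r) ^ S n * (1 - (/ 2) ^ p).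
Proof.
  intros Hr HB Hw. set (q := Cmod w / r).
  assert (Hq : 0 <= q <= / 2).
  { unfold q. split.
    - apply Rdiv_le_0_compat; [apply Cmod_ge_0|easy].
    - apply (Rmult_le_reg_r r); [easy|]. unfold Rdiv.
      rewrite Rmult_assoc, Rinv_l by lra. lra. }
  assert (HB0 : 0 <= B).
  { specialize (HB 0%nat). simpl in HB. pose proof (Cmod_ge_0 (c 0%nat)). lra. }
  assert (Hqn : 0 <= B * q ^ S n) by (apply Rmult_le_pos; [easy|now apply pow_le]).
  induction p as [|p IH].
  - rewrite Nat.add_0_r. replace (cpoly c n w - cpoly c n w)%C with (RtoC 0) by ring.
    rewrite Cmod_0. simpl (/ 2 ^ 0). rewrite pow_O. lra.
  - rewrite Nat.add_succ_r, cpoly_last.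
    replace (cpoly c (n + p) w + c (S (n + p)) * w ^ S (n + p) - cpoly c n w)%C
      with ((cpoly c (n + p) w - cpoly c n w) + c (S (n + p)) * w ^ S (n + p))%C
      by ring.
    eapply Rle_trans; [apply Cmod_triangle|].
    assert (Ht : Cmod (c (S (n + p)) * w ^ S (n + p)) <= B * q ^ S n * (/ 2) ^ p).
    { rewrite Cmod_mult, Cmod_pow.
      replace (Cmod w) with (q * r) by (unfold q; field; lra).
      rewrite Rpow_mult_distr.
      apply Rle_trans with (B * q ^ S (n + p)).
      - specialize (HB (S (n + p))).
        pose proof (pow_le q (S (n + p)) (proj1 Hq)). nra.
      - change (S (n + p)) with (S n + p)%nat. rewrite pow_add, <- Rmult_assoc.
        apply Rmult_le_compat_l; [easy|]. now apply pow_incr. }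
    replace ((/ 2) ^ S p) with (/ 2 * (/ 2) ^ p) by reflexivity.
    lra.
Qed.

(** Convergence at one point of modulus [r] bounds the terms there, and the
    tail is then geometric for [Cmod w <= r / 2]. *)
Lemma pseries_expands n c F z0 rho :
  0 < rho ->
  (forall w, Cmod w < rho ->
     @is_pseries C_AbsRing C_NormedModule c w (F (z0 + w)%C)) ->
  expands n F z0 c.
Proof.
  intros Hrho H.
  set (r := Rmin 1 (rho / 2)).
  assert (Hr : 0 < r /\ r < rho /\ r <= 1).
  { unfold r. pose proof (Rmin_l 1 (rho / 2)). pose proof (Rmin_r 1 (rho / 2)).
    repeat split; try lra. apply Rmin_glb_lt; lra. }
  assert (Hm : Cmod r = r) by (rewrite Cmod_R, Rabs_pos_eq; lra).
  destruct (pseries_terms_bounded c (RtoC r) _ (H (RtoC r) ltac:(lra)))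
    as (B & HB0 & HB).
  rewrite Hm in HB.
  exists (2 * B * (/ r) ^ S n), (r / 2). split.
  { apply Rmult_le_pos; [lra|]. apply pow_le. left. apply Rinv_0_lt_compat. lra. }
  split; [lra|]. intros w Hw.
  apply le_epsilon. intros eps He.
  destruct (pseries_partial_sums c w _ (H w ltac:(lra)) eps He) as (N & HN).
  specialize (HN (n + N)%nat ltac:(lia)).
  pose proof (cpoly_tail_bound c B r w n N (proj1 Hr) HB ltac:(lra)) as Ht.
  replace (F (z0 + w) - cpoly c n w)%C with
    (- (cpoly c (n + N) w - F (z0 + w)) + (cpoly c (n + N) w - cpoly c n w))%C
    by ring.
  eapply Rle_trans; [apply Cmod_triangle|]. rewrite Cmod_opp.
  unfold Rdiv in Ht. rewrite Rpow_mult_distr in Ht.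
  assert (0 <= (/ 2) ^ N) by (apply pow_le; lra).
  assert (0 <= Cmod w ^ S n) by (apply pow_le, Cmod_ge_0).
  assert (0 <= (/ r) ^ S n).
  { apply pow_le. left. apply Rinv_0_lt_compat. lra. }
  assert (0 <= 2 * B * (Cmod w ^ S n * (/ r) ^ S n)).
  { apply Rmult_le_pos; [lra|]. now apply Rmult_le_pos. }
  nra.
Qed.

Lemma analytic_expandable F z0 :
  analytic_in_disk F -> in_disk z0 -> exists A, forall n, expands n F z0 A.
Proof.
  intros HF Hz. destruct (HF z0 Hz) as (c & rho & Hrho & H).
  exists c. intros n. apply (pseries_expands n c F z0 rho Hrho).
  intros w Hw. specialize (H (z0 + w)%C).
  replace (z0 + w - z0)%C with w in H by ring. auto.
Qed.

(** * The maximum principle *)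

(** A sup that is not attained contradicts compactness: if every point [p] has
    a neighborhood where [u < u p + eps p], finitely many neighborhoods cover the
    disk, so that a single [d > 0] is below the [eps p] in use. *)
Lemma disk_max_attained (u : C -> R) (rho : R) :
  0 <= rho ->
  (forall z, Cmod z <= rho -> forall eps, 0 < eps -> exists d, 0 < d /\
     forall w, Cmod w < d -> Rabs (u (z + w)%C - u z) < eps) ->
  exists z, Cmod z <= rho /\ forall z', Cmod z' <= rho -> u z' <= u z.
Proof.
  intros Hrho Hc.
  (* A uniform lower bound [d] for [eps] on enough points [p]. It is applied
     twice: with [eps = 1 / (|u| + 1)], where [d <= eps p] bounds [u p], and with
     [eps = (S - u) / 2], where it keeps [u] below [S - d]. *)
  assert (cover : forall eps : C -> R,
    (forall p, Cmod p <= rho -> 0 < eps p) ->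
    exists d, 0 < d /\ forall z, Cmod z <= rho -> exists p,
      Cmod p <= rho /\ d <= eps p /\ u z < u p + eps p).
  { intros eps Heps.
    (* Squares of half-side [d] lie in disks of radius [2 * d]. The compactness
       lemma is about a square, so points outside the disk need a neighborhood
       too: one that misses the disk. *)
    assert (Hd : forall p : C, exists d : posreal,
       (Cmod p <= rho -> d <= eps p /\
         forall w, Cmod w < 2 * d -> u (p + w)%C < u p + eps p) /\
       (rho < Cmod p -> forall w, Cmod w < 2 * d -> rho < Cmod (p + w)%C)).
    { intros p. destruct (Rle_dec (Cmod p) rho) as [Hp|Hp].
      - destruct (Hc p Hp (eps p) (Heps p Hp)) as (d & Hd & H).
        pose proof (Heps p Hp).
        assert (Hm : 0 < Rmin (d / 2) (eps p)) by (apply Rmin_glb_lt; lra).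
        exists (mkposreal _ Hm). simpl. split; [|intros; lra]. intros _.
        split; [apply Rmin_r|]. intros w Hw.
        pose proof (Rmin_l (d / 2) (eps p)).
        specialize (H w ltac:(lra)). apply Rabs_def2 in H. lra.
      - assert (Hm : 0 < (Cmod p - rho) / 2) by lra.
        exists (mkposreal _ Hm). simpl. split; [intros; lra|].
        intros _ w Hw. pose proof (Cmod_triangle_sub p w). lra. }
    apply (choice (fun p (d : posreal) => _)) in Hd. destruct Hd as (d & Hd).
    destruct (compactness_value_2d (- rho) rho (- rho) rho (fun x y => d (x, y)))
      as (e & He).
    exists e. split; [apply cond_pos|]. intros z Hz.
    pose proof (Rmax_Cmod z) as Hzm.
    assert (H1 : - rho <= fst z <= rho).
    { apply Rabs_le_between. pose proof (Rmax_l (Rabs (fst z)) (Rabs (snd z))). lra. }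
    assert (H2 : - rho <= snd z <= rho).
    { apply Rabs_le_between. pose proof (Rmax_r (Rabs (fst z)) (Rabs (snd z))). lra. }
    specialize (He _ _ H1 H2). apply NNPP in He.
    destruct He as (x & y & _ & _ & Hx & Hy & Hde).
    set (p := (x, y) : C). change (d (x, y)) with (d p) in *.
    assert (Hw : Cmod (z - p) < 2 * d p).
    { eapply Rle_lt_trans; [apply Cmod_2Rmax|].
      assert (HR : Rmax (Rabs (fst (z - p)%C)) (Rabs (snd (z - p)%C)) < d p)
        by (apply Rmax_lub_lt; [exact Hx|exact Hy]).
      assert (Hs : sqrt 2 <= 2).
      { rewrite <- (sqrt_Rsqr 2) at 2 by lra. apply sqrt_le_1_alt. unfold Rsqr. lra. }
      assert (0 <= Rmax (Rabs (fst (z - p)%C)) (Rabs (snd (z - p)%C))).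
      { eapply Rle_trans; [apply Rabs_pos|apply Rmax_l]. }
      nra. }
    destruct (Hd p) as (Hin & Hout).
    destruct (Rle_dec (Cmod p) rho) as [Hp|Hp].
    - exists p. split; [easy|]. destruct (Hin Hp) as (H3 & H4).
      split; [lra|]. specialize (H4 _ Hw).
      now replace (p + (z - p))%C with z in H4 by ring.
    - exfalso. specialize (Hout ltac:(lra) _ Hw).
      replace (p + (z - p))%C with z in Hout by ring. lra. }
  set (E := fun y => exists z, Cmod z <= rho /\ y = u z).
  assert (Hbd : bound E).
  { destruct (cover (fun p => / (Rabs (u p) + 1))) as (d & Hd & H).
    { intros p _. apply Rinv_0_lt_compat. pose proof (Rabs_pos (u p)). lra. }
    exists (/ d + 1). intros y (z & Hz & ->).
    destruct (H z Hz) as (p & _ & H1 & H2).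
    pose proof (Rabs_pos (u p)). pose proof (Rle_abs (u p)).
    assert (Hle1 : / (Rabs (u p) + 1) <= 1).
    { rewrite <- (Rinv_1). apply Rinv_le_contravar; lra. }
    apply Rinv_le_contravar in H1; [|easy]. rewrite Rinv_inv in H1. lra. }
  assert (Hne : exists y, E y).
  { exists (u (RtoC 0)), (RtoC 0). rewrite Cmod_0. auto. }
  destruct (completeness E Hbd Hne) as (S & HS1 & HS2).
  destruct (classic (exists z, Cmod z <= rho /\ S <= u z)) as [(z & Hz & HSz)|Hno].
  - exists z. split; [easy|]. intros z' Hz'.
    apply Rle_trans with S; [|easy]. apply HS1. now exists z'.
  - exfalso.
    destruct (cover (fun p => (S - u p) / 2)) as (d & Hd & H).
    { intros p Hp. destruct (Rle_dec S (u p)); [|lra]. exfalso. eauto. }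
    assert (S <= S - d); [|lra].
    apply HS2. intros y (z & Hz & ->).
    destruct (H z Hz) as (p & _ & H1 & H2). lra.
Qed.

(** Parseval's identity for a polynomial of degree 2 over the rotations of [s] by
    the powers of [i]: the cross terms average out since exponents that differ by
    1 or 2 are distinct modulo 4. *)
Lemma four_point_mean (A : nat -> C) (s : R) :
  Cmod (cpoly A 2 s) ^ 2 + Cmod (cpoly A 2 (Ci * s)) ^ 2
  + Cmod (cpoly A 2 (- s)) ^ 2 + Cmod (cpoly A 2 (- (Ci * s))) ^ 2
  = 4 * (Cmod (A 0%nat) ^ 2 + Cmod (A 1%nat) ^ 2 * s ^ 2
         + Cmod (A 2%nat) ^ 2 * s ^ 4).
Proof.
  rewrite !cpoly_last, !cpoly_0, !Cmod2_alt.
  destruct (A 0%nat) as [a0 b0], (A 1%nat) as [a1 b1], (A 2%nat) as [a2 b2].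
  simpl. ring.
Qed.

Lemma four_point_mean_id (z : C) (s : R) :
  Cmod (z + s) ^ 2 + Cmod (z + Ci * s) ^ 2
  + Cmod (z + - s) ^ 2 + Cmod (z + - (Ci * s)) ^ 2
  = 4 * (Cmod z ^ 2 + s ^ 2).
Proof.
  rewrite !Cmod2_alt. destruct z as [x y]. simpl. ring.
Qed.

Lemma expandable_continuous n F z :
  expandable n F z -> forall eps, 0 < eps -> exists d, 0 < d /\
     forall w, Cmod w < d -> Cmod (F (z + w)%C - F z) < eps.
Proof.
  intros (A & HA) eps He.
  assert (H : bigO 1 (fun w => (F (z + w) - F z)%C)).
  { assert (H1 : bigO 1 (fun w => (F (z + w) - A 0%nat)%C)).
    { destruct n as [|n].
      - eapply bigO_eq; [|exact HA]. intros w. simpl. now rewrite cpoly_0.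
      - assert (HA' := bigO_le 1 _ _ (le_n_S 0 (S n) (Nat.le_0_l _)) HA).
        eapply bigO_eq; [|exact (bigO_plus _ _ _ HA' (bigO_mult 1 0 _ _ bigO_id
          (bigO_cpoly (fun k => A (S k)) n)))].
        intros w. simpl. rewrite cpoly_first. ring. }
    pose proof (expands_value _ _ _ _ HA) as E.
    now rewrite E. }
  destruct H as (K & d & HK & Hd & H).
  assert (Hq : 0 < eps / (K + 1)) by (apply Rdiv_lt_0_compat; lra).
  exists (Rmin d (eps / (K + 1))). split; [apply Rmin_glb_lt; lra|].
  intros w Hw. pose proof (Rmin_l d (eps / (K + 1))).
  pose proof (Rmin_r d (eps / (K + 1))).
  eapply Rle_lt_trans; [apply H; lra|]. rewrite pow_1.
  replace eps with (eps / (K + 1) * (K + 1)) by (field; lra).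
  pose proof (Cmod_ge_0 w). nra.
Qed.

(** The function [u = |L|^2 + e |z|^2] attains its maximum over the disk. Its mean
    over four points at distance [s] of an interior point [z0] is at least
    [u z0 + e s^2 - O(s^3)], by [four_point_mean] and an expansion of order 2, so
    the maximum is not interior. It lies on the circle, and [e] is
    small enough for this to bound [L] at the center. *)
Lemma maximum_principle (L : C -> C) (rho M : R) :
  0 <= rho -> 0 <= M ->
  (forall z, Cmod z <= rho -> expandable 2 L z) ->
  (forall z, Cmod z = rho -> Cmod (L z) <= M) ->
  Cmod (L (RtoC 0)) <= M.
Proof.
  intros Hrho HM HL Hb. apply Rnot_lt_le. intros Hgt.
  set (D := Cmod (L (RtoC 0)) ^ 2 - M ^ 2).
  assert (HD : 0 < D) by (unfold D; nra).
  set (e := D / (2 * (rho ^ 2 + 1))).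
  assert (Hr2 : 0 <= rho ^ 2) by (apply pow_le; easy).
  assert (He : 0 < e) by (apply Rdiv_lt_0_compat; lra).
  assert (Her : e * rho ^ 2 < D).
  { replace D with (e * (2 * (rho ^ 2 + 1))) by (unfold e; field; lra). nra. }
  set (u := fun z => Cmod (L z) ^ 2 + e * Cmod z ^ 2).
  destruct (disk_max_attained u rho Hrho) as (z0 & Hz0 & Hmax).
  { intros z Hz.
    assert (Hcont : forall F : C -> C, expandable 2 F z ->
      forall eps, 0 < eps -> exists d, 0 < d /\ forall w, Cmod w < d ->
        Rabs (Cmod (F (z + w)%C) ^ 2 - Cmod (F z) ^ 2) < eps).
    { intros F HF eps Heps. pose proof (Cmod_ge_0 (F z)) as HFz.
      set (t := Rmin 1 (eps / (2 * Cmod (F z) + 2))).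
      assert (Ht : 0 < t)
        by (apply Rmin_glb_lt; [lra|]; apply Rdiv_lt_0_compat; lra).
      assert (Ht1 : t <= 1) by apply Rmin_l.
      assert (Ht2 : t * (2 * Cmod (F z) + 2) <= eps).
      { replace eps with (eps / (2 * Cmod (F z) + 2) * (2 * Cmod (F z) + 2))
          by (field; lra).
        apply Rmult_le_compat_r; [lra|apply Rmin_r]. }
      destruct (expandable_continuous 2 F z HF t Ht) as (d & Hd & H).
      exists d. split; [easy|]. intros w Hw. specialize (H w Hw).
      pose proof (Cmod_triangle (F (z + w)%C - F z) (F z)) as H1.
      replace (F (z + w)%C - F z + F z)%C with (F (z + w)%C) in H1 by ring.
      pose proof (Cmod_triangle_sub (F z) (F (z + w)%C - F z)) as H2.
      replace (F z + (F (z + w)%C - F z))%C with (F (z + w)%C) in H2 by ring.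
      pose proof (Cmod_ge_0 (F (z + w)%C)).
      apply Rabs_def1; nra. }
    intros eps Heps.
    destruct (Hcont L (HL z Hz) (eps / 2) ltac:(lra)) as (d1 & Hd1 & H1).
    assert (Heps2 : 0 < eps / (2 * e)) by (apply Rdiv_lt_0_compat; lra).
    destruct (Hcont (fun z => z) (expandable_id 2 z) _ Heps2) as (d2 & Hd2 & H2).
    exists (Rmin d1 d2). split; [now apply Rmin_glb_lt|]. intros w Hw.
    pose proof (Rmin_l d1 d2). pose proof (Rmin_r d1 d2).
    specialize (H1 w ltac:(lra)). specialize (H2 w ltac:(lra)).
    apply Rabs_def2 in H1, H2. unfold u.
    assert (E : e * (eps / (2 * e)) = eps / 2) by (field; lra).
    apply Rabs_def1; nra. }
  assert (Hin : Cmod z0 < rho).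
  { destruct (Rle_lt_or_eq_dec _ _ Hz0) as [|Heq]; [easy|exfalso].
    specialize (Hmax (RtoC 0) ltac:(rewrite Cmod_0; lra)). unfold u in Hmax.
    rewrite Cmod_0, Heq in Hmax. specialize (Hb z0 Heq).
    assert (Cmod (L z0) ^ 2 <= M ^ 2)
      by (apply pow_incr; split; [apply Cmod_ge_0|easy]).
    unfold D in *. simpl in *. lra. }
  destruct (HL z0 Hz0) as (A & HA').
  pose proof (expands_value _ _ _ _ HA') as E0.
  destruct HA' as (K & d & HK & Hd & HA).
  destruct (bigO_cpoly A 2) as (B & d' & HB & Hd' & HP).
  assert (Hpt : forall s w, 0 < s -> s < d -> s < d' -> s < rho - Cmod z0 ->
    Cmod w = s ->
    Cmod (cpoly A 2 w) ^ 2 - 2 * B * K * s ^ 3 + e * Cmod (z0 + w) ^ 2 <= u z0).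
  { intros s w Hs Hsd Hsd' Hsr Hw.
    assert (Hz : Cmod (z0 + w) <= rho).
    { pose proof (Cmod_triangle z0 w). lra. }
    specialize (Hmax _ Hz). unfold u at 1 in Hmax.
    specialize (HA w ltac:(lra)). specialize (HP w ltac:(lra)).
    pose proof (Cmod2_plus_ge (cpoly A 2 w) (L (z0 + w)%C - cpoly A 2 w)) as H.
    replace (cpoly A 2 w + (L (z0 + w)%C - cpoly A 2 w))%C
      with (L (z0 + w)%C) in H by ring.
    rewrite Hw in HA, HP. rewrite pow_O, Rmult_1_r in HP.
    assert (Cmod (cpoly A 2 w) * Cmod (L (z0 + w)%C - cpoly A 2 w)
            <= B * (K * s ^ 3))
      by (apply Rmult_le_compat; auto using Cmod_ge_0).
    lra. }
  assert (e <= 0); [|lra].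
  apply (nonpos_of_small_multiples e (2 * B * K) (Rmin d (Rmin d' (rho - Cmod z0)))).
  { repeat apply Rmin_glb_lt; lra. }
  intros s [Hs Hlt].
  pose proof (Rmin_l d (Rmin d' (rho - Cmod z0))).
  pose proof (Rmin_r d (Rmin d' (rho - Cmod z0))).
  pose proof (Rmin_l d' (rho - Cmod z0)).
  pose proof (Rmin_r d' (rho - Cmod z0)).
  assert (Es : Cmod s = s) by (rewrite Cmod_R, Rabs_pos_eq; lra).
  assert (Eis : Cmod (Ci * s) = s) by (rewrite Cmod_mult, Cmod_Ci, Es; ring).
  pose proof (Hpt s (RtoC s) Hs ltac:(lra) ltac:(lra) ltac:(lra) Es) as P1.
  pose proof (Hpt s (Ci * s)%C Hs ltac:(lra) ltac:(lra) ltac:(lra) Eis) as P2.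
  pose proof (Hpt s (- s)%C Hs ltac:(lra) ltac:(lra) ltac:(lra)
                ltac:(now rewrite Cmod_opp)) as P3.
  pose proof (Hpt s (- (Ci * s))%C Hs ltac:(lra) ltac:(lra) ltac:(lra)
                ltac:(now rewrite Cmod_opp)) as P4.
  pose proof (four_point_mean A s) as Q1.
  pose proof (four_point_mean_id z0 s) as Q2.
  unfold u in P1, P2, P3, P4. rewrite E0 in *.
  assert (0 <= Cmod (A 1%nat) ^ 2 * s ^ 2) by (apply Rmult_le_pos; apply pow2_ge_0).
  assert (0 <= Cmod (A 2%nat) ^ 2 * s ^ 4)
    by (apply Rmult_le_pos; apply pow_le; [apply Cmod_ge_0|lra]).
  assert (Hfin : e * s ^ 2 <= 2 * B * K * s ^ 3) by nra.
  apply (Rmult_le_reg_r (s ^ 2)); [now apply pow_lt|].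
  eapply Rle_trans; [exact Hfin|]. right. ring.
Qed.

(** * Sums over the roots of unity *)

Definition zeta (N : nat) : C := (cos (2 * PI / INR N), sin (2 * PI / INR N)).

Lemma zeta_pow N k :
  (zeta N ^ k)%C = (cos (2 * PI / INR N * INR k), sin (2 * PI / INR N * INR k)).
Proof.
  induction k as [|k IH].
  - simpl. rewrite Rmult_0_r, cos_0, sin_0. reflexivity.
  - simpl Cpow. rewrite IH, S_INR, Rmult_plus_distr_l, Rmult_1_r, cos_plus, sin_plus.
    unfold zeta, Cmult. simpl. f_equal; ring.
Qed.

Lemma zeta_pow_mod N k : Cmod (zeta N ^ k) = 1.
Proof.
  rewrite zeta_pow. unfold Cmod. simpl. rewrite !Rmult_1_r.
  rewrite <- sqrt_1. f_equal. rewrite Rplus_comm. apply sin2_cos2.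
Qed.

Lemma zeta_pow_N N : (zeta (S N) ^ S N)%C = RtoC 1.
Proof.
  rewrite zeta_pow. unfold RtoC.
  replace (2 * PI / INR (S N) * INR (S N)) with (2 * PI)
    by (field; apply not_0_INR; lia).
  now rewrite cos_2PI, sin_2PI.
Qed.

Lemma zeta_primitive N k : (0 < k <= N)%nat -> (zeta (S N) ^ k)%C <> RtoC 1.
Proof.
  intros Hk He. rewrite zeta_pow in He. apply (f_equal fst) in He. simpl in He.
  set (t := PI / INR (S N) * INR k).
  assert (HN : 0 < INR (S N)) by (apply lt_0_INR; lia).
  assert (Ht : 0 < t < PI).
  { assert (0 < INR k) by (apply lt_0_INR; lia).
    assert (INR k < INR (S N)) by (apply lt_INR; lia).
    pose proof PI_RGT_0.
    assert (E : t * INR (S N) = PI * INR k) by (unfold t; field; lra).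
    split; nra. }
  replace (2 * PI / _ * INR k) with (2 * t) in He
    by (unfold t; change (match N with 0%nat => 1 | S _ => INR N + 1 end)
          with (INR (S N)); field; lra).
  rewrite cos_2a_sin in He.
  pose proof (sin_gt_0 t (proj1 Ht) (proj2 Ht)). nra.
Qed.

Lemma geometric_sum (x : C) n :
  ((x - 1) * sum_n (fun j => (x ^ j)%C) n)%C = (x ^ S n - 1)%C.
Proof.
  induction n as [|n IH].
  - rewrite sum_O. simpl. ring.
  - rewrite sum_n_C_S, Cmult_plus_distr_l, IH. simpl. ring.
Qed.

Lemma zeta_conj_inv N k : (zeta N ^ k * Cconj (zeta N) ^ k)%C = RtoC 1.
Proof.
  rewrite <- Cpow_conj, <- Cmod2_conj, zeta_pow_mod. f_equal. ring.
Qed.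

Lemma Cpow_swap (x : C) j k : ((x ^ j) ^ k)%C = ((x ^ k) ^ j)%C.
Proof. rewrite <- !Cpow_mult_r. f_equal. lia. Qed.

(** A geometric sum whose ratio [x] is an [(S M)]-th root of unity, equal to 1
    only when [k = l] because both exponents are at most [M]. *)
Lemma zeta_orthogonal M k l :
  (k <= M)%nat -> (l <= M)%nat ->
  @eq C (sum_n (fun j => ((zeta (S M) ^ j) ^ k * (Cconj (zeta (S M)) ^ j) ^ l)%C) M)
    (if Nat.eq_dec k l then RtoC (INR (S M)) else RtoC 0).
Proof.
  intros Hk Hl. set (z := zeta (S M)).
  set (x := (z ^ k * Cconj z ^ l)%C).
  assert (Ex : @eq C (sum_n (fun j => ((z ^ j) ^ k * (Cconj z ^ j) ^ l)%C) M)
                 (sum_n (fun j => (x ^ j)%C) M)).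
  { apply (@sum_n_ext C_AbelianMonoid). intros j. unfold x.
    now rewrite (Cpow_swap z), (Cpow_swap (Cconj z)), Cpow_mult_l. }
  rewrite Ex. destruct (Nat.eq_dec k l) as [<-|Hkl].
  - assert (E1 : x = RtoC 1) by apply zeta_conj_inv. rewrite E1. clear.
    induction M as [|M IH].
    + rewrite sum_O. reflexivity.
    + rewrite sum_n_C_S, IH, Cpow_1_l, (S_INR (S M)), RtoC_plus. reflexivity.
  - assert (Hx1 : x <> RtoC 1).
    { intros E. destruct (Nat.lt_total k l) as [Hlt|[?|Hlt]]; [| contradiction |].
      - apply (zeta_primitive M (l - k)); [lia|].
        assert (E' : (z ^ l)%C = (z ^ k)%C).
        { rewrite <- (Cmult_1_l (z ^ l)), <- E. unfold x.
          rewrite <- Cmult_assoc, (Cmult_comm (Cconj z ^ l)).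
          unfold z. rewrite zeta_conj_inv. ring. }
        replace l with (k + (l - k))%nat in E' at 1 by lia.
        rewrite Cpow_add_r in E'. fold z.
        transitivity (z ^ k * Cconj z ^ k * z ^ (l - k))%C.
        + unfold z. rewrite zeta_conj_inv. fold z. ring.
        + transitivity (z ^ k * z ^ (l - k) * Cconj z ^ k)%C; [ring|].
          rewrite E'. apply zeta_conj_inv.
      - apply (zeta_primitive M (k - l)); [lia|]. fold z.
        rewrite <- E. unfold x. replace k with ((k - l) + l)%nat at 2 by lia.
        rewrite Cpow_add_r, <- Cmult_assoc. unfold z.
        rewrite zeta_conj_inv. ring. }
    assert (HxN : (x ^ S M)%C = RtoC 1).
    { unfold x. rewrite Cpow_mult_l, (Cpow_swap z), (Cpow_swap (Cconj z)).
      rewrite <- (Cpow_conj z (S M)). unfold z at 1 2. rewrite zeta_pow_N.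
      replace (Cconj (RtoC 1)) with (RtoC 1)
        by (unfold Cconj, RtoC; simpl; now rewrite Ropp_0).
      rewrite !Cpow_1_l. ring. }
    pose proof (geometric_sum x M) as Hg. rewrite HxN in Hg.
    assert (Hd : (x - 1)%C <> RtoC 0).
    { intros E. apply Hx1. replace x with (x - 1 + 1)%C by ring. rewrite E. ring. }
    rewrite <- (Cmult_1_l (sum_n _ M)), <- (Cinv_l (x - 1) Hd), <- Cmult_assoc, Hg.
    ring.
Qed.

Lemma sum_roots_cpoly_monomial M X p l :
  (p <= M)%nat -> (l <= M)%nat ->
  @eq C (sum_n (fun j => (cpoly X p (zeta (S M) ^ j)
                          * (Cconj (zeta (S M)) ^ j) ^ l)%C) M)
    (if le_dec l p then (INR (S M) * X l)%C else RtoC 0).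
Proof.
  intros Hp Hl. set (z := zeta (S M)). induction p as [|p IH].
  - transitivity (X 0%nat * sum_n (fun j => ((z ^ j) ^ 0 * (Cconj z ^ j) ^ l)%C) M)%C.
    { rewrite <- sum_n_C_scal. apply (@sum_n_ext C_AbelianMonoid). intros j.
      rewrite cpoly_0. simpl. rewrite Cmult_1_l. reflexivity. }
    unfold z. rewrite zeta_orthogonal by lia.
    destruct (le_dec l 0) as [H|H], (Nat.eq_dec 0 l) as [H'|H']; try lia;
      [subst l|]; ring.
  - transitivity (sum_n (fun j => (cpoly X p (z ^ j) * (Cconj z ^ j) ^ l)%C) M
       + X (S p) * sum_n (fun j => ((z ^ j) ^ (S p) * (Cconj z ^ j) ^ l)%C) M)%C.
    { rewrite <- sum_n_C_scal, <- sum_n_C_plus.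
      apply (@sum_n_ext C_AbelianMonoid). intros j. rewrite cpoly_last.
      change (@eq C ((cpoly X p (z ^ j) + X (S p) * (z ^ j) ^ S p) * (Cconj z ^ j) ^ l)
        (cpoly X p (z ^ j) * (Cconj z ^ j) ^ l
         + X (S p) * ((z ^ j) ^ S p * (Cconj z ^ j) ^ l)))%C. ring. }
    rewrite IH by lia. unfold z. rewrite zeta_orthogonal by lia.
    destruct (le_dec l p), (Nat.eq_dec (S p) l), (le_dec l (S p)); try lia;
      try subst l; ring.
Qed.

(** With more sample points than the degree there is no aliasing, so the
    discrete mean value is exact. The degrees differ so that this serves both
    for Parseval's identity and for extracting low-order coefficients. *)
Lemma discrete_parseval_bilinear M X Y p q :
  (q <= p)%nat -> (p <= M)%nat ->
  @eq C (sum_n (fun j => (cpoly X p (zeta (S M) ^ j)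
                          * cpoly Y q (Cconj (zeta (S M)) ^ j))%C) M)
    (INR (S M) * sum_n (fun k => (X k * Y k)%C) q)%C.
Proof.
  intros Hq Hp. set (z := zeta (S M)).
  assert (Hstep : forall l, (l <= p)%nat ->
    @eq C (sum_n (fun j => (cpoly X p (z ^ j) * (Cconj z ^ j) ^ l)%C) M)
      (INR (S M) * X l)%C).
  { intros l Hl. unfold z. rewrite sum_roots_cpoly_monomial by lia.
    destruct (le_dec l p); [reflexivity|lia]. }
  induction q as [|q IH].
  - transitivity (Y 0%nat * sum_n (fun j => (cpoly X p (z ^ j) * (Cconj z ^ j) ^ 0)%C) M)%C.
    { rewrite <- sum_n_C_scal. apply (@sum_n_ext C_AbelianMonoid). intros j.
      rewrite cpoly_0. change ((Cconj z ^ j) ^ 0)%C with (RtoC 1).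
      rewrite Cmult_1_r. apply Cmult_comm. }
    rewrite Hstep by lia. rewrite sum_O. ring.
  - transitivity (sum_n (fun j => (cpoly X p (z ^ j) * cpoly Y q (Cconj z ^ j))%C) M
       + Y (S q) * sum_n (fun j => (cpoly X p (z ^ j) * (Cconj z ^ j) ^ (S q))%C) M)%C.
    { rewrite <- sum_n_C_scal, <- sum_n_C_plus.
      apply (@sum_n_ext C_AbelianMonoid). intros j. rewrite cpoly_last.
      change (@eq C
        (cpoly X p (z ^ j) * (cpoly Y q (Cconj z ^ j) + Y (S q) * (Cconj z ^ j) ^ S q))
        (cpoly X p (z ^ j) * cpoly Y q (Cconj z ^ j)
         + Y (S q) * (cpoly X p (z ^ j) * (Cconj z ^ j) ^ S q)))%C. ring. }
    rewrite IH, Hstep, sum_n_C_S by lia. ring.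
Qed.

Lemma discrete_parseval M X p (z : C) :
  (p <= M)%nat ->
  sum_n (fun j => Cmod (cpoly X p (zeta (S M) ^ j * z)) ^ 2) M
  = INR (S M) * sum_n (fun k => Cmod (X k) ^ 2 * Cmod z ^ (2 * k)) p.
Proof.
  intros Hp. apply RtoC_inj. rewrite RtoC_mult, <- !sum_n_RtoC.
  transitivity (sum_n (fun j => (cpoly (fun k => (X k * z ^ k)%C) p (zeta (S M) ^ j)
     * cpoly (fun k => Cconj (X k * z ^ k)%C) p (Cconj (zeta (S M)) ^ j))%C) M).
  { apply (@sum_n_ext C_AbelianMonoid). intros j.
    rewrite Cmod2_conj, (Cmult_comm (zeta _ ^ j) z), cpoly_scale_arg, cpoly_conj, Cpow_conj.
    reflexivity. }
  rewrite discrete_parseval_bilinear by lia. f_equal.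
  apply (@sum_n_ext C_AbelianMonoid). intros k.
  rewrite <- Cmod2_conj, Cmod_mult, Cmod_pow, Rpow_mult_distr, pow_mult.
  rewrite <- !pow_mult, Nat.mul_comm. reflexivity.
Qed.

(** * Coefficients of a function dominated by a polynomial *)

Lemma Cmod_mean_le (f : nat -> C) M c :
  (forall j, (j <= M)%nat -> Cmod (f j) <= c) ->
  Cmod (/ INR (S M) * sum_n f M) <= c.
Proof.
  intros H. assert (HN : 0 < INR (S M)) by (apply lt_0_INR; lia).
  rewrite Cmod_mult, <- RtoC_inv, Cmod_R by lra.
  rewrite Rabs_pos_eq by (left; now apply Rinv_0_lt_compat).
  apply (Rmult_le_reg_l (INR (S M))); [easy|].
  rewrite <- Rmult_assoc, Rinv_r, Rmult_1_l by lra.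
  eapply Rle_trans; [apply Cmod_sum_n|].
  rewrite <- sum_n_const. now apply sum_n_R_le.
Qed.

(** Applied with [t = Cmod w] and [u] of order [1 / w], this says that a
    polynomial of degree [n] in [1 / w] grows at most like [w ^ (- n)]. *)
Lemma cpoly_growth A n u t :
  0 <= t <= 1 -> Cmod u * t <= 1 ->
  Cmod (cpoly A n u) * t ^ n <= sum_n (fun k => Cmod (A k)) n.
Proof.
  intros Ht Hu. induction n as [|n IH].
  - rewrite cpoly_0, sum_O. simpl. lra.
  - rewrite cpoly_last, sum_n_R_S.
    pose proof (Cmod_triangle (cpoly A n u) (A (S n) * u ^ S n)) as H.
    rewrite Cmod_mult, Cmod_pow in H.
    pose proof (pow_le t (S n) (proj1 Ht)) as Hp.
    pose proof (pow_le t n (proj1 Ht)) as Hpn.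
    assert (H1 : (Cmod u * t) ^ S n <= 1).
    { rewrite <- (pow1 (S n)). apply pow_incr. split; [|easy].
      apply Rmult_le_pos; [apply Cmod_ge_0|easy]. }
    rewrite Rpow_mult_distr in H1.
    pose proof (Cmod_ge_0 (A (S n))). pose proof (Cmod_ge_0 (cpoly A n u)).
    assert (Hshift : Cmod (cpoly A n u) * t ^ S n <= Cmod (cpoly A n u) * t ^ n).
    { apply Rmult_le_compat_l; [easy|]. simpl. nra. }
    eapply Rle_trans; [apply Rmult_le_compat_r; [exact Hp|exact H]|]. nra.
Qed.

Definition disk_expandable (F : C -> C) : Prop :=
  forall z, in_disk z -> expandable 2 F z.

(** A duality argument. Let [P_e] be the partial sum of degree [n] with
    coefficients [e], and [D x] the polynomial with conjugate coefficients at
    [rho^2 / x]. On the circle of radius [rho], [D x] is the conjugate of [P_e x];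
    unlike the conjugate, it is analytic off 0. Let [L] be the mean of [F D] over
    the rotations by the [n + 3] roots of unity. The rotations kill the negative
    powers, and [L] extends to 0 with value [Se], the left-hand side. On the
    circle [2 |F D| <= |P_h|^2 + |P_e|^2], whose mean is [Sh + Se] by Parseval. The
    maximum principle gives [2 Se <= Sh + Se]. *)
Lemma coefficient_bound_radius F e h n rho :
  0 < rho < 1 -> disk_expandable F -> expands (n + 2) F 0 e ->
  (forall z, in_disk z -> Cmod (F z) <= Cmod (cpoly h n z)) ->
  sum_n (fun k => Cmod (e k) ^ 2 * rho ^ (2 * k)) n
  <= sum_n (fun k => Cmod (h k) ^ 2 * rho ^ (2 * k)) n.
Proof.
  intros Hrho HF He Hle.
  set (Se := sum_n (fun k => Cmod (e k) ^ 2 * rho ^ (2 * k)) n).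
  set (Sh := sum_n (fun k => Cmod (h k) ^ 2 * rho ^ (2 * k)) n).
  set (M := (n + 2)%nat). set (N := INR (S M)). set (z := zeta (S M)).
  assert (HN : 0 < N) by (apply lt_0_INR; lia).
  assert (HNC : RtoC N <> RtoC 0) by (intros E; apply RtoC_inj in E; lra).
  assert (Hz : forall j, Cmod (z ^ j) = 1) by (intros j; apply zeta_pow_mod).
  assert (Hrot : forall j x, Cmod (z ^ j * x) = Cmod x)
    by (intros j x; rewrite Cmod_mult, Hz; ring).
  set (D := fun x : C => cpoly (fun k => Cconj (e k)) n (RtoC (rho ^ 2) * / x)%C).
  set (G := fun (x : C) j => (F (z ^ j * x) * D (z ^ j * x))%C).
  set (L := fun x => if Req_EM_T (Cmod x) 0 then RtoC Se
                     else (/ N * sum_n (G x) M)%C).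
  assert (Hnn : forall a : nat -> C,
     0 <= sum_n (fun k => Cmod (a k) ^ 2 * rho ^ (2 * k)) n).
  { intros a. apply Rle_trans with (sum_n (fun _ : nat => 0) n).
    { rewrite sum_n_const. lra. }
    apply sum_n_R_le. intros k _. apply Rmult_le_pos; apply pow_le.
    - apply Cmod_ge_0.
    - lra. }
  assert (H0 : L (RtoC 0) = RtoC Se).
  { unfold L. rewrite Cmod_0. now destruct (Req_EM_T 0 0). }
  enough (Hmax : Cmod (L (RtoC 0)) <= (Sh + Se) / 2).
  { rewrite H0, Cmod_R, Rabs_pos_eq in Hmax by apply Hnn. lra. }
  apply (maximum_principle L rho).
  - lra.
  - pose proof (Hnn e : 0 <= Se). pose proof (Hnn h : 0 <= Sh). lra.
  - intros x Hx. destruct (Req_EM_T (Cmod x) 0) as [Hx0|Hx0].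
    + (* At 0 the coefficients of order at most [n + 2] contribute exactly [Se],
         and the remainder [O(w^(n + 3))] of [F] absorbs the pole of order [n] of
         [D] with a factor [w^3] to spare. *)
      apply Cmod_eq_0 in Hx0. subst x.
      exists (fun k => match k with 0%nat => RtoC Se | _ => RtoC 0 end).
      destruct He as (K & d & HK & Hd & HR).
      exists (K * sum_n (fun k => Cmod (Cconj (e k))) n), d. split.
      { apply Rmult_le_pos; [easy|].
        eapply Rle_trans; [apply Cmod_ge_0|apply Cmod_sum_n]. }
      split; [easy|]. intros w Hw.
      assert (Ep : cpoly (fun k => match k with 0%nat => RtoC Se | _ => RtoC 0 end) 2 w
                   = RtoC Se) by (rewrite !cpoly_last, cpoly_0; ring).
      rewrite Ep, Cplus_0_l. unfold L.
      destruct (Req_EM_T (Cmod w) 0) as [Hw0|Hw0].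
      { replace (RtoC Se - RtoC Se)%C with (RtoC 0) by ring.
        rewrite Cmod_0, Hw0. simpl. lra. }
      assert (Hwp : 0 < Cmod w) by (pose proof (Cmod_ge_0 w); lra).
      assert (Hwnz : w <> RtoC 0) by now apply Cmod_gt_0.
      assert (ESe : RtoC Se = (/ N * sum_n (fun j => (cpoly e M (z ^ j * w)
                                               * D (z ^ j * w))%C) M)%C).
      { transitivity (/ N * sum_n (fun j => (cpoly (fun k => (e k * w ^ k)%C) M (z ^ j)
          * cpoly (fun k => (Cconj (e k) * (RtoC (rho ^ 2) * / w) ^ k)%C) n
              (Cconj z ^ j))%C) M)%C.
        - unfold z. rewrite discrete_parseval_bilinear by lia.
          fold N. rewrite Cmult_assoc, (Cinv_l _ HNC), Cmult_1_l.
          unfold Se. rewrite <- sum_n_RtoC.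
          apply (@sum_n_ext C_AbelianMonoid). intros k.
          rewrite RtoC_mult, Cmod2_conj, pow_mult, (RtoC_pow (rho ^ 2)).
          rewrite Cpow_mult_l, Cpow_inv by easy.
          assert (Hwk : (w ^ k)%C <> RtoC 0) by now apply Cpow_nz.
          change (@eq C (e k * Cconj (e k) * (rho ^ 2)%R ^ k)
            (e k * w ^ k * (Cconj (e k) * ((rho ^ 2)%R ^ k * / w ^ k))))%C.
          now field.
        - f_equal. apply (@sum_n_ext C_AbelianMonoid). intros j. unfold D.
          rewrite (Cmult_comm (z ^ j) w), cpoly_scale_arg. f_equal.
          rewrite <- cpoly_scale_arg. f_equal.
          assert (Hzj : (z ^ j)%C <> RtoC 0)
            by (apply Cmod_gt_0; rewrite Hz; lra).
          replace (Cconj z ^ j)%C with (/ (z ^ j))%C; [now field|].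
          rewrite <- (Cmult_1_l (Cconj z ^ j)), <- (Cinv_l _ Hzj), <- Cmult_assoc.
          unfold z. rewrite zeta_conj_inv. ring. }
      rewrite ESe at 1.
      replace (/ N * sum_n (G w) M
         - / N * sum_n (fun j => (cpoly e M (z ^ j * w) * D (z ^ j * w))%C) M)%C
        with (/ N * sum_n (fun j => (G w j
               + -(1) * (cpoly e M (z ^ j * w) * D (z ^ j * w)))%C) M)%C
        by (rewrite sum_n_C_plus, sum_n_C_scal; ring).
      apply Cmod_mean_le. intros j _. unfold G.
      replace (F (z ^ j * w) * D (z ^ j * w)
               + - (1) * (cpoly e M (z ^ j * w) * D (z ^ j * w)))%C
        with ((F (0 + z ^ j * w) - cpoly e M (z ^ j * w)) * D (z ^ j * w))%C
        by (rewrite Cplus_0_l; ring).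
      rewrite Cmod_mult.
      specialize (HR (z ^ j * w)%C ltac:(now rewrite Hrot)). rewrite Hrot in HR.
      fold M in HR.
      assert (HD : Cmod (D (z ^ j * w)%C) * Cmod w ^ n
                   <= sum_n (fun k => Cmod (Cconj (e k))) n).
      { apply cpoly_growth; [lra|].
        rewrite Cmod_mult, Cmod_inv, Hrot, Cmod_R, Rabs_pos_eq.
        - rewrite Rmult_assoc, Rinv_l by lra. simpl. nra.
        - apply pow_le. lra.
        - apply Cmod_gt_0. now rewrite Hrot. }
      replace (S M) with (n + 3)%nat in HR by (unfold M; lia).
      rewrite pow_add in HR.
      pose proof (Cmod_ge_0 (D (z ^ j * w)%C)) as HD0.
      assert (0 <= Cmod w ^ 3) by (apply pow_le; lra).
      assert (H1 : K * Cmod w ^ 3 * (Cmod (D (z ^ j * w)%C) * Cmod w ^ n)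
        <= K * Cmod w ^ 3 * sum_n (fun k => Cmod (Cconj (e k))) n).
      { apply Rmult_le_compat_l; [|easy]. now apply Rmult_le_pos. }
      eapply Rle_trans; [apply Rmult_le_compat_r; [exact HD0|exact HR]|].
      lra.
    + apply (expandable_local _ (fun x => (/ N * sum_n (fun j => G x j) M)%C)).
      { exists (Cmod x). pose proof (Cmod_ge_0 x). split; [lra|].
        intros w Hw. unfold L.
        destruct (Req_EM_T (Cmod (x + w)%C) 0) as [E|E]; [|reflexivity].
        pose proof (Cmod_triangle_sub x w). lra. }
      apply expandable_mult; [apply expandable_const|].
      apply (expandable_sum 2 (fun j x => G x j)). intros j _. unfold G.
      assert (Hxj : (z ^ j * x)%C <> RtoC 0).
      { apply Cmod_gt_0. rewrite Hrot. pose proof (Cmod_ge_0 x). lra. }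
      apply (expandable_rotate 2 (fun y => (F y * D y)%C)).
      apply expandable_mult.
      * apply HF. unfold in_disk. rewrite Hrot. lra.
      * unfold D. apply expandable_cpoly, expandable_mult;
          [apply expandable_const|now apply expandable_inv].
  - intros x Hx. unfold L.
    destruct (Req_EM_T (Cmod x) 0) as [E|_]; [lra|].
    rewrite Cmod_mult, <- RtoC_inv, Cmod_R by lra.
    rewrite Rabs_pos_eq by (left; now apply Rinv_0_lt_compat).
    apply (Rmult_le_reg_l N); [easy|].
    rewrite <- Rmult_assoc, Rinv_r, Rmult_1_l by lra.
    replace (N * ((Sh + Se) / 2)) with (/ 2 * (N * Sh + N * Se)) by field.
    unfold Sh, Se. rewrite <- Hx. unfold N.
    rewrite <- !(discrete_parseval M) by lia. fold z.
    eapply Rle_trans; [apply Cmod_sum_n|].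
    assert (HG : forall j, Cmod (G x j)
      <= / 2 * (Cmod (cpoly h n (z ^ j * x)%C) ^ 2 + Cmod (cpoly e n (z ^ j * x)%C) ^ 2)).
    { intros j. unfold G. rewrite Cmod_mult.
      set (y := (z ^ j * x)%C).
      assert (Hy : Cmod y = rho) by (unfold y; now rewrite Hrot).
      assert (Hynz : y <> RtoC 0) by (apply Cmod_gt_0; lra).
      assert (ED : D y = Cconj (cpoly e n y)).
      { rewrite cpoly_conj. unfold D. f_equal. rewrite <- Hy, Cmod2_conj.
        now field. }
      rewrite ED, Cmod_conj.
      specialize (Hle y ltac:(unfold in_disk; lra)).
      pose proof (Cmod_ge_0 (F y)). pose proof (Cmod_ge_0 (cpoly e n y)).
      assert (Cmod (F y) ^ 2 <= Cmod (cpoly h n y) ^ 2)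
        by (apply pow_incr; easy).
      pose proof (pow2_ge_0 (Cmod (F y) - Cmod (cpoly e n y))).
      nra. }
    eapply Rle_trans; [apply sum_n_R_le; intros j _; exact (HG j)|].
    rewrite sum_n_R_scal, sum_n_R_plus. apply Rle_refl.
Qed.

Lemma one_minus_pow_le s m : 0 <= s <= 1 -> 1 - INR m * s <= (1 - s) ^ m <= 1.
Proof.
  intros Hs. induction m as [|m IH].
  - simpl. lra.
  - rewrite S_INR. simpl. pose proof (pos_INR m).
    assert (0 <= (1 - s) ^ m) by (apply pow_le; lra). nra.
Qed.

(** The radius tends to 1, with [s = 1 - rho] and Bernoulli's inequality. *)
Lemma coefficient_bound F e h n :
  disk_expandable F -> expands (n + 2) F 0 e ->
  (forall z, in_disk z -> Cmod (F z) <= Cmod (cpoly h n z)) ->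
  sum_n (fun k => Cmod (e k) ^ 2) n <= sum_n (fun k => Cmod (h k) ^ 2) n.
Proof.
  intros HF He Hle.
  set (Se := sum_n (fun k => Cmod (e k) ^ 2) n).
  set (Sh := sum_n (fun k => Cmod (h k) ^ 2) n).
  enough (Se - Sh <= 0) by lra.
  apply (nonpos_of_small_multiples _ (INR (2 * n) * Se) 1); [lra|]. intros s Hs.
  pose proof (coefficient_bound_radius F e h n (1 - s) ltac:(lra) HF He Hle) as H.
  assert (H1 : (1 - INR (2 * n) * s) * Se
     <= sum_n (fun k => Cmod (e k) ^ 2 * (1 - s) ^ (2 * k)) n).
  { unfold Se. rewrite <- sum_n_R_scal. apply sum_n_R_le. intros k Hk.
    rewrite Rmult_comm. apply Rmult_le_compat_l; [apply pow2_ge_0|].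
    pose proof (one_minus_pow_le s (2 * k) ltac:(lra)).
    assert (INR (2 * k) <= INR (2 * n)) by (apply le_INR; lia). nra. }
  assert (H2 : sum_n (fun k => Cmod (h k) ^ 2 * (1 - s) ^ (2 * k)) n <= Sh).
  { apply sum_n_R_le. intros k _.
    pose proof (one_minus_pow_le s (2 * k) ltac:(lra)).
    pose proof (pow2_ge_0 (Cmod (h k))). nra. }
  lra.
Qed.

Lemma disk_expandable_of_analytic F : analytic_in_disk F -> disk_expandable F.
Proof.
  intros HF z Hz. destruct (analytic_expandable F z HF Hz) as (A & HA).
  now exists A.
Qed.

(** * Rogosinski's inequality *)

(** Multiplication by a function bounded by 1 is a contraction for the square
    norm of truncated sequences. *)
Lemma conv_contraction phi c h n :
  disk_expandable phi -> (forall m, expands m phi 0 c) ->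
  (forall z, in_disk z -> Cmod (phi z) <= 1) ->
  sum_n (fun k => Cmod (conv c h k) ^ 2) n <= sum_n (fun k => Cmod (h k) ^ 2) n.
Proof.
  intros Hphi Hc Hle.
  (* The polynomial with coefficients [h] up to [n], seen as having all its
     higher coefficients equal to 0: this changes no coefficient of the product
     up to [n]. *)
  set (h' := fun k => if le_dec k n then h k else RtoC 0).
  assert (Hh' : forall k, (k <= n)%nat -> h' k = h k).
  { intros k Hk. unfold h'. now destruct (le_dec k n). }
  assert (Hp : forall m z, cpoly h' (n + m) z = cpoly h n z).
  { intros m z. induction m as [|m IH].
    - rewrite Nat.add_0_r. now apply cpoly_ext.
    - rewrite Nat.add_succ_r, cpoly_last, IH. unfold h'.
      destruct (le_dec (S (n + m)) n); [lia|ring]. }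
  assert (He : expands (n + 2) (fun z => (phi z * cpoly h n z)%C) 0 (conv c h')).
  { apply expands_mult; [apply Hc|].
    apply (bigO_eq _ (fun _ => RtoC 0)); [|apply bigO_zero].
    intros w. rewrite Hp, Cplus_0_l. ring. }
  replace (sum_n (fun k => Cmod (conv c h k) ^ 2) n)
    with (sum_n (fun k => Cmod (conv c h' k) ^ 2) n).
  - refine (coefficient_bound _ _ h n _ He _).
    + intros z Hz. apply expandable_mult; [now apply Hphi|].
      apply (expandable_cpoly 2 h n (fun z => z)), expandable_id.
    + intros z Hz. rewrite Cmod_mult. specialize (Hle z Hz).
      pose proof (Cmod_ge_0 (phi z)). pose proof (Cmod_ge_0 (cpoly h n z)). nra.
  - apply sum_n_ext_loc. intros k Hk. do 2 f_equal. apply conv_ext_r.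
    intros i Hi. apply Hh'. lia.
Qed.

(** The coefficients of [cpoly a d (phi z)] when [phi] has coefficients [c], by
    Horner's scheme. *)
Fixpoint compose (a c : nat -> C) (d : nat) : nat -> C :=
  match d with
  | 0%nat => fun k => match k with 0%nat => a 0%nat | _ => RtoC 0 end
  | S d' => fun k =>
      ((match k with 0%nat => a 0%nat | _ => RtoC 0 end)
       + conv c (compose (fun i => a (S i)) c d') k)%C
  end.

Lemma expands_compose phi c a d n z0 :
  expands n phi z0 c ->
  expands n (fun z => cpoly a d (phi z)) z0 (compose a c d).
Proof.
  intros Hc. revert a. induction d as [|d IH]; intros a.
  - apply (expands_local n (fun _ => a 0%nat)).
    + exists 1. split; [lra|]. intros w _. now rewrite cpoly_0.
    + apply expands_const.
  - eapply expands_local.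
    2: exact (expands_plus _ _ _ _ _ _ (expands_const n (a 0%nat) z0)
         (expands_mult _ _ _ _ _ _ Hc (IH (fun i => a (S i))))).
    exists 1. split; [lra|]. intros w _. now rewrite cpoly_first.
Qed.

Lemma conv_0 c h : c 0%nat = RtoC 0 -> conv c h 0 = RtoC 0.
Proof. intros H. simpl. rewrite H. ring. Qed.

(** Littlewood's subordination principle. Write the polynomial as
    [a 0 + z q(z)], so that the composite is [a 0 + phi (q o phi)]. Since
    [phi] vanishes at 0, the two summands have disjoint sets of coefficients and
    their squares add up; the second is handled by the contraction property and
    by induction on the degree. *)
Lemma compose_energy phi c a d n :
  disk_expandable phi -> (forall m, expands m phi 0 c) ->
  (forall z, in_disk z -> Cmod (phi z) <= 1) -> c 0%nat = RtoC 0 ->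
  sum_n (fun k => Cmod (compose a c d k) ^ 2) n
  <= sum_n (fun k => Cmod (a k) ^ 2) d.
Proof.
  intros Hphi Hc Hle Hc0. revert a. induction d as [|d IH]; intros a.
  - rewrite sum_O. right. induction n as [|n IHn].
    + rewrite sum_O. reflexivity.
    + rewrite sum_n_R_S, IHn. simpl. rewrite Cmod_0. ring.
  - rewrite (sum_n_R_first _ d). specialize (IH (fun i => a (S i))).
    pose proof (conv_contraction phi c (compose (fun i => a (S i)) c d) n
      Hphi Hc Hle) as H.
    assert (E : @eq R (sum_n (fun k => Cmod (compose a c (S d) k) ^ 2) n)
      (Cmod (a 0%nat) ^ 2
       + sum_n (fun k => Cmod (conv c (compose (fun i => a (S i)) c d) k) ^ 2) n)).
    { clear IH H. induction n as [|n IHn].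
      - rewrite !sum_O. cbn [compose]. rewrite conv_0 by easy.
        rewrite Cplus_0_r, Cmod_0. ring.
      - rewrite !sum_n_R_S, IHn. cbn [compose]. rewrite Cplus_0_l. ring. }
    rewrite E. lra.
Qed.

(** Up to order [n], the coefficients of [g = f o phi] are those of the
    composite of [phi] with the partial sum of degree [n] of [f], because
    [phi z = O(z)]. *)
Lemma rogosinski f g a b n :
  (forall m, expands m f 0 a) -> (forall m, expands m g 0 b) ->
  subordinate g f ->
  sum_n (fun k => Cmod (b k) ^ 2) n <= sum_n (fun k => Cmod (a k) ^ 2) n.
Proof.
  intros Ha Hb (phi & Hphi & Hphi0 & Hle & Hg).
  assert (Hin0 : in_disk 0) by (unfold in_disk; rewrite Cmod_0; lra).
  destruct (analytic_expandable phi 0 Hphi Hin0) as (c & Hc).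
  assert (Hc0 : c 0%nat = RtoC 0)
    by now rewrite <- (expands_value 0 phi 0 c (Hc 0%nat)).
  assert (Hsmall : bigO 1 (fun w => phi (0 + w)%C)).
  { eapply bigO_eq; [|exact (Hc 0%nat)]. intros w. simpl.
    rewrite cpoly_0, Hc0. ring. }
  assert (Hcomp : expands n g 0 (compose a c n)).
  { assert (H1 := bigO_comp _ _ _ (Ha n) Hsmall).
    assert (H2 := expands_compose phi c a n n 0 (Hc n)).
    eapply bigO_ext; [|exact (bigO_plus _ _ _ H1 H2)].
    exists 1. split; [lra|]. intros w Hw. simpl.
    rewrite !Cplus_0_l, Hg by easy. ring. }
  rewrite (sum_n_ext_loc _ (fun k => Cmod (compose a c n k) ^ 2)).
  - apply (compose_energy phi); auto.
    + now apply disk_expandable_of_analytic.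
    + intros z Hz. left. auto.
  - intros k Hk. do 2 f_equal. now apply (expands_unique n g 0).
Qed.

(** * Comparison of majorant series *)

(** Summation by parts, as an induction: passing from [n] to [S n] lowers the
    weight of the nonnegative sum over the first [n] terms. *)
Lemma weighted_sum_ge (D lam : nat -> R) n :
  (forall k, 0 <= sum_n D k) -> (forall k, 0 <= lam (S k) <= lam k) ->
  lam n * sum_n D n <= sum_n (fun k => lam k * D k) n.
Proof.
  intros HD Hl. induction n as [|n IH].
  - rewrite !sum_O. lra.
  - rewrite !sum_n_R_S. specialize (HD n). specialize (Hl n). nra.
Qed.

(** From [m] on, the weight [lam k = r ^ k / A k] is nonincreasing by the ratio
    hypothesis, so the sums of [lam k * B k ^ 2] are at most those of [lam k * A k ^ 2], which is
    [A k * r ^ k]. The inequality between arithmetic and geometric means gives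
    [2 * B k * r ^ k <= lam k * B k ^ 2 + A k * r ^ k]. *)
Lemma majorant_partial_sums (A B : nat -> R) (m n : nat) (r : R) :
  0 <= r ->
  (forall k, sum_n (fun i => B i ^ 2) k <= sum_n (fun i => A i ^ 2) k) ->
  (forall k, (k < m)%nat -> B k = A k) ->
  (forall k, (m <= k)%nat -> 0 < A k) ->
  (forall k, (m <= k)%nat -> r * A k <= A (S k)) ->
  sum_n (fun k => B k * r ^ k) n <= sum_n (fun k => A k * r ^ k) n.
Proof.
  intros Hr Henergy Heq Hpos Hratio.
  set (D := fun k => A k ^ 2 - B k ^ 2).
  (* Constant below [m], where [D] vanishes and [A] may do so. *)
  set (lam := fun k => r ^ max k m / A (max k m)).
  assert (HD : forall k, 0 <= sum_n D k).
  { intros k. assert (E : @eq R (sum_n D k) (sum_n (fun i => A i ^ 2) k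
                                             - sum_n (fun i => B i ^ 2) k)).
    { induction k as [|k IH].
      - now rewrite !sum_O.
      - rewrite !sum_n_R_S, IH. unfold D. ring. }
    rewrite E. specialize (Henergy k). lra. }
  assert (Hlam0 : forall k, 0 <= lam k).
  { intros k. apply Rdiv_le_0_compat; [now apply pow_le|].
    apply Hpos. lia. }
  assert (Hlam : forall k, 0 <= lam (S k) <= lam k).
  { intros k. split; [apply Hlam0|]. unfold lam.
    destruct (le_dec m k) as [Hk|Hk].
    - rewrite !Nat.max_l by lia.
      pose proof (Hpos k Hk). pose proof (Hpos (S k) ltac:(lia)).
      specialize (Hratio k Hk). pose proof (pow_le r k Hr).
      apply (Rmult_le_reg_r (A (S k) * A k)); [now apply Rmult_lt_0_compat|].
      replace (r ^ S k / A (S k) * (A (S k) * A k)) with (r ^ k * (r * A k))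
        by (simpl; field; lra).
      replace (r ^ k / A k * (A (S k) * A k)) with (r ^ k * A (S k))
        by (field; lra).
      now apply Rmult_le_compat_l.
    - rewrite !Nat.max_r by lia. lra. }
  pose proof (weighted_sum_ge D lam n HD Hlam) as Hw.
  assert (H0 : 0 <= sum_n (fun k => lam k * D k) n).
  { eapply Rle_trans; [|exact Hw]. apply Rmult_le_pos; auto. }
  assert (H1 : sum_n (fun k => B k * r ^ k + / 2 * (lam k * D k)) n
               <= sum_n (fun k => A k * r ^ k) n).
  { apply sum_n_R_le. intros k _. destruct (le_dec m k) as [Hk|Hk].
    - unfold lam, D. rewrite Nat.max_l by lia. pose proof (Hpos k Hk) as HA.
      pose proof (pow_le r k Hr).
      assert (E : A k * r ^ k - (B k * r ^ k + / 2 * (r ^ k / A k * (A k ^ 2 - B k ^ 2)))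
                  = r ^ k * (A k - B k) ^ 2 / (2 * A k)) by (field; lra).
      assert (0 <= r ^ k * (A k - B k) ^ 2 / (2 * A k)).
      { apply Rdiv_le_0_compat; [|lra]. apply Rmult_le_pos; [easy|apply pow2_ge_0]. }
      lra.
    - unfold D. rewrite Heq by lia. lra. }
  rewrite sum_n_R_plus, sum_n_R_scal in H1. lra.
Qed.

Lemma expansion_expands m A F : expansion_from m A F -> forall n, expands n F 0 A.
Proof.
  intros (_ & H) n. apply (pseries_expands n A F 0 1); [lra|].
  intros w Hw. rewrite Cplus_0_l. now apply H.
Qed.

Lemma majorant_converges m A F r :
  expansion_from m A F -> 0 <= r < 1 -> ex_series (fun n => Cmod (A n) * r ^ n).
Proof.
  intros (_ & H) Hr. set (s := (1 + r) / 2).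
  assert (Hs : Cmod s = s) by (rewrite Cmod_R, Rabs_pos_eq; unfold s; lra).
  destruct (pseries_terms_bounded A s _
              (H (RtoC s) ltac:(unfold in_disk; rewrite Hs; unfold s; lra)))
    as (B & HB & HA).
  rewrite Hs in HA.
  apply (@ex_series_le R_AbsRing R_CompleteNormedModule _ (fun n => B * (r / s) ^ n)).
  - intros n. change (Rabs (Cmod (A n) * r ^ n) <= B * (r / s) ^ n).
    rewrite Rabs_pos_eq
      by (apply Rmult_le_pos; [apply Cmod_ge_0|apply pow_le; lra]).
    replace (r ^ n) with (s ^ n * (r / s) ^ n)
      by (rewrite <- Rpow_mult_distr; f_equal; unfold s; field; lra).
    rewrite <- Rmult_assoc. apply Rmult_le_compat_r; [|apply HA].
    apply pow_le, Rdiv_le_0_compat; unfold s; lra.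
  - apply (@ex_series_scal_l R_AbsRing). apply ex_series_geom.
    rewrite Rabs_pos_eq by (apply Rdiv_le_0_compat; unfold s; lra).
    apply (Rmult_lt_reg_r s); [unfold s; lra|]. unfold Rdiv.
    rewrite Rmult_assoc, Rinv_l; unfold s; lra.
Qed.

Lemma Series_le_partial (u v : nat -> R) :
  ex_series u -> ex_series v -> (forall n, sum_n u n <= sum_n v n) ->
  Series u <= Series v.
Proof.
  intros Hu Hv H.
  exact (is_lim_seq_le _ _ (Finite (Series u)) (Finite (Series v)) H
           (Series_correct u Hu) (Series_correct v Hv)).
Qed.

Lemma inf_ratio_bound A k r :
  (forall n, (k <= n)%nat -> A n <> RtoC 0) ->
  Rbar_le (Finite r) (inf_ratio A k) ->
  forall n, (k <= n)%nat -> r * Cmod (A n) <= Cmod (A (S n)).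
Proof.
  intros Hnz Hr n Hn. unfold inf_ratio in Hr.
  pose proof (Inf_seq_correct
    (fun j => Finite (Cmod (A (S (k + j)) / A (k + j)%nat)%C))) as Hi.
  apply is_inf_seq_glb in Hi. destruct Hi as (Hi & _).
  specialize (Hi _ (ex_intro _ (n - k)%nat eq_refl)).
  pose proof (Rbar_le_trans _ _ _ Hr Hi) as H. simpl in H.
  replace (k + (n - k))%nat with n in H by lia.
  rewrite Cmod_div in H by auto.
  pose proof (proj1 (Cmod_gt_0 _) (Hnz n Hn)).
  apply (Rmult_le_compat_r (Cmod (A n))) in H; [|lra].
  replace (Cmod (A (S n)) / Cmod (A n) * Cmod (A n)) with (Cmod (A (S n))) in H
    by (field; lra).
  exact H.
Qed.

(** Indices below [p] carry equal coefficients and are exempt from the ratio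
    condition: [p = m] when [m >= 1], and [p = 1] when [m = 0]. *)
Lemma majorant_series_le m p a b f g z :
  expansion_from m a f -> expansion_from m b g -> subordinate g f ->
  (forall k, (k < p)%nat -> b k = a k) ->
  (forall k, (p <= k)%nat -> a k <> RtoC 0) ->
  in_disk z -> Rbar_le (Finite (Cmod z)) (inf_ratio a p) ->
  majorant_series b (Cmod z) <= majorant_series a (Cmod z).
Proof.
  intros Ha Hb Hsub Hlow Hnz Hz Hr.
  assert (Hz' : 0 <= Cmod z < 1) by (split; [apply Cmod_ge_0|exact Hz]).
  apply Series_le_partial.
  - now apply (majorant_converges m b g).
  - now apply (majorant_converges m a f).
  - intros n. apply (majorant_partial_sums (fun k => Cmod (a k)) (fun k => Cmod (b k)) p).
    + easy.
    + intros k. apply (rogosinski f g); eauto using expansion_expands.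
    + intros k Hk. now rewrite Hlow.
    + intros k Hk. now apply Cmod_gt_0, Hnz.
    + now apply inf_ratio_bound.
Qed.

Theorem lemma1 (m : nat) (a b : nat -> C) (f g : C -> C)
  (hf : analytic_in_disk f) (hg : analytic_in_disk g)
  (hfa : expansion_from m a f) (hgb : expansion_from m b g)
  (hgf : subordinate g f)
  (ha : forall n : nat, (m <= n)%nat -> a n <> RtoC 0) :
  ((1 <= m)%nat ->
    forall z : C, in_disk z ->
      Rbar_le (Finite (Cmod z)) (inf_ratio a m) ->
      (majorant_series b (Cmod z) <= majorant_series a (Cmod z))%R) /\
  (m = 0%nat ->
    forall z : C, in_disk z ->
      Rbar_le (Finite (Cmod z)) (inf_ratio a 1) ->
      (majorant_series b (Cmod z) <= majorant_series a (Cmod z))%R).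
Proof.
  split; intros Hm z Hz Hr.
  - apply (majorant_series_le m m a b f g); auto.
    intros k Hk. now rewrite (proj1 hfa), (proj1 hgb).
  - apply (majorant_series_le m 1 a b f g); auto.
    + (* The constant terms agree: [g 0 = f (phi 0) = f 0]. *)
      intros k Hk. replace k with 0%nat by lia.
      destruct hgf as (phi & _ & Hphi0 & _ & Hg).
      rewrite <- (expands_value 0 f 0 a), <- (expands_value 0 g 0 b)
        by eauto using expansion_expands.
      rewrite Hg, Hphi0; [reflexivity|]. unfold in_disk. rewrite Cmod_0. lra.
    + intros k Hk. apply ha. lia.
Qed.
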